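(* If $G$ is a finite connected bipartite planar graph, then $\mathrm{cc}(G)\le 4$. Furthermore, there exists a bipartite planar graph $H$ with $\mathrm{cc}(H)=4$.
   Context: All graphs are finite, connected and reflexive (a loop at every vertex; moving along a loop means passing); loops are ignored for planarity and bipartiteness. Cops and Attacking Robbers: the cop player places $k$ cops on vertices, then the robber chooses a vertex. In each round the cops move (each cop moves to an adjacent vertex or passes), then the robber moves (to an adjacent vertex or passes). The cops win if after finitely many moves a cop moves onto the robber's vertex. Additionally, if the robber moves onto a vertex occupied by a cop, exactly one cop on that vertex is removed from the game; the robber's initial placement on a cop's vertex does not count as an attack. Both players play optimally. The attacking cop number $\mathrm{cc}(G)$ is the least $k$ such that $k$ cops can guarantee a win. *)

(* Defs.v *)
From Stdlib Require Import Reals.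
From mathcomp Require Import all_boot.

Set Implicit Arguments.
Unset Strict Implicit.
Unset Printing Implicit Defensive.

Section Graphs.
Variable V : finType.
Variable e : rel V.

(* A finite simple graph is a symmetric irreflexive relation; every vertex
   additionally carries a loop (reflexivity), handled by [adjr]. *)
Definition simple_graph : Prop := symmetric e /\ irreflexive e.

Definition connected_graph : Prop :=
  0 < #|V| /\ forall x y : V, connect e x y.

Definition bipartite : Prop :=
  exists col : V -> bool, forall x y, e x y -> col x != col y.

Definition in01 (t : R) : Prop := Rle R0 t /\ Rle t R1.
Definition in01o (t : R) : Prop := Rlt R0 t /\ Rlt t R1.

Definition planar : Prop :=
  exists (pos : V -> R * R) (arc : V -> V -> R -> R * R),
    injective pos /\
    (forall x y, e x y ->
       continuity (fun t => fst (arc x y t)) /\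
       continuity (fun t => snd (arc x y t)) /\
       arc x y R0 = pos x /\ arc x y R1 = pos y /\
       (forall s t, in01 s -> in01 t -> arc x y s = arc x y t -> s = t) /\
       (forall z s, in01o s -> arc x y s <> pos z)) /\
    (forall x y u w, e x y -> e u w ->
       ~ ((x == u) && (y == w) || (x == w) && (y == u)) ->
       forall s t, in01o s -> in01o t -> arc x y s <> arc u w t).

Definition adjr (x y : V) : bool := (x == y) || e x y.

(* [cops_win cs r]: it is the cops' turn, the remaining cops stand at [cs]
   (one entry per cop) and the robber at [r]; the cops can force a capture in
   finitely many moves.  Cops move simultaneously (each to an adjacent vertex
   or passing); if a cop lands on [r] the cops win; otherwise the robber moves
   to [r'] (adjacent or passing) and, if [r'] holds a cop, exactly one cop on
   [r'] is removed ([rem r' cs']). *)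
Inductive cops_win : seq V -> V -> Prop :=
| CopsWin : forall cs r cs',
    all2 adjr cs cs' ->
    (r \in cs' \/ forall r', adjr r r' -> cops_win (rem r' cs') r') ->
    cops_win cs r.

(* [k] cops can guarantee a win: some placement of [k] cops wins against
   every initial robber vertex (initial placement on a cop is no attack). *)
Definition k_cops_win (k : nat) : Prop :=
  exists cs : seq V, size cs = k /\ forall r : V, cops_win cs r.

Definition is_cc (k : nat) : Prop :=
  k_cops_win k /\ forall j, j < k -> ~ k_cops_win j.

End Graphs.

(* Main.v *)
Require Import Defs.
From Stdlib Require Import Reals Lra Lia Btauto Ring Classical ClassicalEpsilon.
From Coquelicot Require Compactness.
From mathcomp Require Import all_boot zify.

(** Upper bound.  The robber is confined to a connected territory whose
    boundary lies on a path, or on a cycle cut into two segments, each segment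
    being guarded by one cop.  A guard stands on the image of the robber under
    a folding of the territory onto a geodesic; bipartiteness gives the guard
    the robber's colour, so he is never adjacent to the robber when the robber
    moves and cannot be attacked.  The two other cops meet outside the
    territory, where the robber cannot go without being captured, and walk
    together along a shortest path joining two boundary vertices through the
    territory until they stand on the robber's image; one of them then guards
    this path.  Planarity says that what is left of the territory cannot touch
    this chord and both sides of the cycle, so that two guards suffice again.

    Planarity is used only through the absence of a drawing of K_{3,3} by
    continuous curves in which independent edges are disjoint.  This is a
    mod 2 winding argument: if two sampled curves stay apart, the difference of
    their points has even winding along the boundary of the parameter square,
    and the sum of these relations over all independent pairs of edges of
    K_{3,3} reads 0 = 1.

    Lower bound.  In the dodecahedron with every edge subdivided once, a cop
    controls at most one of the three ways out of an original vertex, and a cop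
    adjacent to the robber can be attacked unless another cop protects him;
    three cops therefore never trap the robber. *)

Set Implicit Arguments.
Unset Strict Implicit.
Unset Printing Implicit Defensive.

Local Delimit Scope R_scope with Re.

(** * Parity of crossings *)

Definition far (d : R) (p q : R * R) : Prop :=
  Rle d (Rabs (p.1 - q.1)) \/ Rle d (Rabs (p.2 - q.2)).

Definition near (d : R) (p q : R * R) : Prop :=
  Rlt (Rabs (p.1 - q.1)) d /\ Rlt (Rabs (p.2 - q.2)) d.

Definition ltRb (x y : R) : bool := if Rlt_dec x y then true else false.

Lemma ltRbP x y : reflect (Rlt x y) (ltRb x y).
Proof. by rewrite /ltRb; case: Rlt_dec => h; constructor. Qed.

(* The lexicographic order makes [lexpos p q] the negation of [lexpos q p]
   for all distinct points, without any general position assumption. *)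
Definition lexpos (p q : R * R) : bool :=
  ltRb q.2 p.2 || (~~ ltRb p.2 q.2 && ltRb q.1 p.1).

Definition xpos (p q : R * R) : bool := ltRb q.1 p.1.

(* Does the short step from [p] to [p'] cross the horizontal ray to the right
   of [q]? *)
Definition crossL (p p' q : R * R) : bool :=
  xorb (lexpos p q) (lexpos p' q) && xpos p q.

(* The same for the difference [p - q] when [q] moves to [q']. *)
Definition crossR (p q q' : R * R) : bool :=
  xorb (lexpos p q) (lexpos p q') && xpos p q.

Ltac split_ltRb :=
  rewrite /lexpos /xpos /=;
  repeat match goal with
  | |- context [ltRb ?a ?b] => case: (ltRbP a b) => ? /=
  end.

Lemma far_lexpos d p q : Rlt R0 d -> far d p q -> lexpos q p = ~~ lexpos p q.
Proof.
move=> d0; case: p q => [a b] [a' b'] /=; rewrite /far /= => h.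
have : a <> a' \/ b <> b'.
  by case: h => h; [left | right] => E; move: h; rewrite E Rminus_diag Rabs_R0; lra.
by case=> /Rdichotomy [] ?; split_ltRb => //; lra.
Qed.

(** A vertical gap of at least [d / 2] keeps its sign while each point moves by less than [d / 4];
    when it is smaller, the horizontal gap is at least [d] and keeps its sign. *)
Lemma cell_dichotomy d p p' q q' : Rlt R0 d ->
  far d p q -> far d p q' -> far d p' q -> far d p' q' ->
  near (d / 4) p p' -> near (d / 4) q q' ->
  [/\ lexpos p' q = lexpos p q, lexpos p q' = lexpos p q
    & lexpos p' q' = lexpos p q] \/
  [/\ xpos p' q = xpos p q, xpos p q' = xpos p q
    & xpos p' q' = xpos p q].
Proof.
move=> d0; case: p p' q q' => [a b] [a' b'] [c f] [c' f'].
rewrite /far /near /=.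
set u := Rabs (a - a'); set v := Rabs (b - b').
move=> h1 h2 h3 h4 [h5 h6] [h7 h8].
move: h5 h6 h7 h8; rewrite /u /v => {u v}.
move/Rabs_def2=> [? ?] /Rabs_def2 [? ?] /Rabs_def2 [? ?] /Rabs_def2 [? ?].
case: (Rle_dec d (Rabs (b - f))) => hbf.
  left; move: hbf; rewrite /(Rabs (b - f)); case: (Rcase_abs (b - f)) => ? ?;
  split; split_ltRb => //; lra.
case: h1 => // hac.
case: (Rle_dec (d / 2) (Rabs (b - f))) => hbf2.
  left; move: hbf2; rewrite /(Rabs (b - f)); case: (Rcase_abs (b - f)) => ? ?;
  split; split_ltRb => //; lra.
right; move: hac; rewrite /(Rabs (a - c)).
by case: (Rcase_abs (a - c)) => ? ?; split; split_ltRb => //; lra.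
Qed.

(** If [lexpos] is constant on the cell, nothing crosses; if [xpos] is constant, it factors out and
    each [lexpos] term occurs twice. *)
Lemma cell_parity d p p' q q' : Rlt R0 d ->
  far d p q -> far d p q' -> far d p' q -> far d p' q' ->
  near (d / 4) p p' -> near (d / 4) q q' ->
  xorb (xorb (crossL p p' q) (crossL p p' q'))
       (xorb (crossR p q q') (crossR p' q q')) = false.
Proof.
move=> d0 h1 h2 h3 h4 h5 h6; rewrite /crossL /crossR.
by case: (cell_dichotomy d0 h1 h2 h3 h4 h5 h6) => -[e1 e2 e3];
  rewrite ?e1 ?e2 ?e3; btauto.
Qed.

Lemma far_near_xpos d p q q' : Rlt R0 d ->
  far d p q -> far d p q' -> near (d / 4) q q' ->
  lexpos p q <> lexpos p q' -> xpos q p = ~~ xpos p q.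
Proof.
move=> d0; case: p q q' => [a b] [c f] [c' f'].
rewrite /far /near /= => h1 h2 [/Rabs_def2 [? ?] /Rabs_def2 [? ?]].
case: (Req_dec a c) => [eac|nac]; last first.
  by case: (Rdichotomy _ _ nac) => ? _; split_ltRb => //; lra.
subst c => hs; exfalso; apply: hs; move: h1.
rewrite Rminus_diag Rabs_R0 => -[?|]; first lra.
rewrite /(Rabs (b - f)); case: (Rcase_abs (b - f)) => ? ?;
  split_ltRb => //; lra.
Qed.

(** As [q] moves, [p] crosses the right ray of [q] when [q] crosses the left ray of [p]. The
    [lexpos] terms count crossings of the whole horizontal line through [p], and so exchange left
    and right. *)
Lemma crossR_crossL d p q q' : Rlt R0 d ->
  far d p q -> far d p q' -> near (d / 4) q q' ->
  crossR p q q' = xorb (crossL q q' p) (xorb (lexpos q p) (lexpos q' p)).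
Proof.
move=> d0 h1 h2 h3; rewrite /crossR /crossL.
rewrite (far_lexpos d0 h1) (far_lexpos d0 h2).
case E: (lexpos p q == lexpos p q'); first by rewrite (eqP E); case: (lexpos p q').
rewrite (far_near_xpos d0 h1 h2 h3); last by move/eqP: E.
by move: E; case: (lexpos p q); case: (lexpos p q'); case: (xpos p q).
Qed.

Fixpoint xsum (f : nat -> bool) (n : nat) : bool :=
  if n is m.+1 then xorb (xsum f m) (f m) else false.

Lemma eq_xsum f g n : (forall i, i < n -> f i = g i) -> xsum f n = xsum g n.
Proof.
elim: n => //= n IH h; rewrite h // IH // => i lt; exact/h/ltnW.
Qed.

Lemma xsum_xorb f g n :
  xsum (fun i => xorb (f i) (g i)) n = xorb (xsum f n) (xsum g n).
Proof. by elim: n => //= n ->; btauto. Qed.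

Lemma xsum_telescope f n :
  xsum (fun i => xorb (f i) (f i.+1)) n = xorb (f 0) (f n).
Proof. elim: n => [|n /= ->]; first by rewrite /=; btauto. btauto. Qed.

(** * Winding parities of sampled curves *)

Section PolygonalCurves.

Variable d : R.
Hypothesis d_gt0 : Rlt R0 d.

Definition fine (L : nat -> R * R) (m : nat) : Prop :=
  forall i, i < m -> near (d / 4) (L i) (L i.+1).

Definition apart (L : nat -> R * R) m (M : nat -> R * R) n : Prop :=
  forall i j, i <= m -> j <= n -> far d (L i) (M j).

(* Parity of the number of crossings of [L] with the ray issued from [z]. *)
Definition wind (L : nat -> R * R) (m : nat) (z : R * R) : bool :=
  xsum (fun i => crossL (L i) (L i.+1) z) m.

Definition windR (z : R * R) (M : nat -> R * R) (n : nat) : bool :=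
  xsum (fun j => crossR z (M j) (M j.+1)) n.

(** Cells of one row of the parameter grid are summed; the sides shared by neighbouring cells
    cancel. *)
Lemma strip_parity p p' M n :
  near (d / 4) p p' -> fine M n ->
  (forall j, j <= n -> far d p (M j)) -> (forall j, j <= n -> far d p' (M j)) ->
  xorb (xorb (crossL p p' (M 0)) (crossL p p' (M n)))
       (xorb (windR p M n) (windR p' M n)) = false.
Proof.
move=> npp; elim: n => [|n IH] fM fp fp'.
  by rewrite /windR /wind /=; btauto.
have {}IH := IH (fun i h => fM i (ltnW h)) (fun j h => fp j (leqW h))
  (fun j h => fp' j (leqW h)).
have := cell_parity d_gt0 (fp n (leqnSn n)) (fp n.+1 (leqnn _))
  (fp' n (leqnSn n)) (fp' n.+1 (leqnn _)) npp (fM n (leqnn _)).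
move: IH; rewrite /windR /=; move: (crossL p p' (M 0)) => a.
move: (crossL _ _ _) (crossL _ _ _) (xsum _ _) (xsum _ _).
move: (crossR _ _ _) (crossR _ _ _).
by case: a; do 6 case.
Qed.

(** Summing the rows leaves the boundary of the parameter square, along which the difference of the
    two points has even winding. *)
Lemma square_parity L m M n : fine L m -> fine M n -> apart L m M n ->
  xorb (xorb (wind L m (M 0)) (wind L m (M n)))
       (xorb (windR (L 0) M n) (windR (L m) M n)) = false.
Proof.
elim: m => [|m IH] fL fM ap.
  by rewrite /windR /wind /=; btauto.
have {}IH := IH (fun i h => fL i (ltnW h)) fM
  (fun i j hi hj => ap i j (leqW hi) hj).
have := strip_parity (fL m (leqnn _)) fM (fun j => ap m j (leqnSn m))
  (fun j => ap m.+1 j (leqnn _)).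
move: IH; rewrite /wind /=; move: (windR (L 0) M n) => a.
move: (windR _ _ _) (windR _ _ _) (xsum _ _) (xsum _ _).
move: (crossL _ _ _) (crossL _ _ _).
by case: a; do 6 case.
Qed.

Lemma windR_wind z M n : fine M n -> (forall j, j <= n -> far d z (M j)) ->
  windR z M n = xorb (wind M n z) (xorb (lexpos (M 0) z) (lexpos (M n) z)).
Proof.
move=> fM fz; rewrite -(xsum_telescope (fun j => lexpos (M j) z)) -xsum_xorb.
apply: eq_xsum => j lt; apply: (@crossR_crossL d) => //; last exact: fM.
  exact/fz/ltnW.
exact: fz.
Qed.

Lemma disjoint_curves_parity L m M n : fine L m -> fine M n -> apart L m M n ->
  xorb (xorb (wind L m (M 0)) (wind L m (M n)))
    (xorb (xorb (wind M n (L 0)) (wind M n (L m)))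
      (xorb (xorb (lexpos (M 0) (L 0)) (lexpos (M n) (L 0)))
            (xorb (lexpos (M 0) (L m)) (lexpos (M n) (L m))))) = false.
Proof.
move=> fL fM ap; have := square_parity fL fM ap.
rewrite !windR_wind // => [|j hj|j hj]; [|exact: ap|exact: ap].
move=> <-; btauto.
Qed.

(* Summing [disjoint_curves_parity] over the 18 independent pairs of edges of
   K_{3,3}, every winding parity occurs twice and every [lexpos] an even number
   of times up to orientation; the 45 reorientations make the total odd. *)
Lemma K33_no_drawing (a b : 'I_3 -> R * R) (L : 'I_3 -> 'I_3 -> nat -> R * R)
    (m : 'I_3 -> 'I_3 -> nat) :
  (forall i j, L i j 0 = a i) -> (forall i j, L i j (m i j) = b j) ->
  (forall i j, fine (L i j) (m i j)) ->
  ~ (forall i j k l, i != k -> j != l ->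
       apart (L i j) (m i j) (L k l) (m k l)).
Proof.
move=> L0 Lm Lf ap.
have far_aa i k : i != k -> far d (a i) (a k).
  move=> ik; have [j [l jl]] : exists j l : 'I_3, j != l.
    by exists ord0, ord_max.
  by have := ap i j k l ik jl 0 0 isT isT; rewrite !L0.
have far_bb j l : j != l -> far d (b j) (b l).
  move=> jl; have [i [k ik]] : exists j l : 'I_3, j != l.
    by exists ord0, ord_max.
  have := ap i j k l ik jl (m i j) (m k l) (leqnn _) (leqnn _).
  by rewrite !Lm.
have far_ab i l : far d (a i) (b l).
  have [k ik] : exists k : 'I_3, i != k.
    by case: (eqVneq i ord0) => [->|]; [exists ord_max | exists ord0].
  have [j jl] : exists k : 'I_3, k != l.
    by case: (eqVneq l ord0) => [->|?]; [exists ord_max | exists ord0; rewrite eq_sym].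
  have := ap i j k l ik jl 0 (m k l) isT (leqnn _).
  by rewrite L0 Lm.
pose n i j z := wind (L i j) (m i j) z.
have E i j k l : i != k -> j != l ->
  xorb (xorb (n i j (a k)) (n i j (b l)))
    (xorb (xorb (n k l (a i)) (n k l (b j)))
      (xorb (xorb (lexpos (a k) (a i)) (lexpos (b l) (a i)))
            (xorb (lexpos (a k) (b j)) (lexpos (b l) (b j))))) = false.
  move=> ik jl; have := disjoint_curves_parity (Lf i j) (Lf k l) (ap i j k l ik jl).
  by rewrite !L0 !Lm.
pose o0 : 'I_3 := @Ordinal 3 0 isT.
pose o1 : 'I_3 := @Ordinal 3 1 isT.
pose o2 : 'I_3 := @Ordinal 3 2 isT.
have Sa i k : i != k -> lexpos (a k) (a i) = ~~ lexpos (a i) (a k).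
  by move=> h; apply: (@far_lexpos d) => //; apply: far_aa.
have Sb i k : i != k -> lexpos (b k) (b i) = ~~ lexpos (b i) (b k).
  by move=> h; apply: (@far_lexpos d) => //; apply: far_bb.
have Sab i k : lexpos (b k) (a i) = ~~ lexpos (a i) (b k).
  exact: (@far_lexpos d).
pose F i k j l := xorb (xorb (n i j (a k)) (n i j (b l)))
    (xorb (xorb (n k l (a i)) (n k l (b j)))
      (xorb (xorb (lexpos (a k) (a i)) (lexpos (b l) (a i)))
            (xorb (lexpos (a k) (b j)) (lexpos (b l) (b j))))).
(* For fixed [i], [k] these are the six ordered pairs of distinct [j], [l]; the three choices of
   [i < k] give all 18 relations. *)
pose G i k := xorb (xorb (F i k o0 o1) (xorb (F i k o0 o2) (F i k o1 o2)))
  (xorb (F i k o1 o0) (xorb (F i k o2 o0) (F i k o2 o1))).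
have : xorb (G o0 o1) (xorb (G o0 o2) (G o1 o2)) = false.
  by rewrite /G /F !E.
rewrite /G /F !Sab (@Sa o0 o1) // (@Sa o0 o2) // (@Sa o1 o2) //.
rewrite (@Sb o0 o1) // (@Sb o0 o2) // (@Sb o1 o2) //.
move=> H; suff: true = false by [].
rewrite -H; clear.
(* With negation written as addition of [true], the identity is one of Boolean polynomials, left to
   [ring]. *)
have negE c : ~~ c = xorb true c by case: c.
rewrite !negE; ring.
Qed.

End PolygonalCurves.

(** * From continuous drawings to K_{3,3} *)

Definition continuous2 (f : R -> R * R) : Prop :=
  continuity (fun t => (f t).1) /\ continuity (fun t => (f t).2).

Lemma continuity_ball (f : R -> R) x eps : continuity f -> Rlt R0 eps ->
  exists2 a, Rlt R0 a &
    forall y, Rlt (Rabs (y - x)) a -> Rlt (Rabs (f y - f x)) eps.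
Proof.
move=> cf e0; have [a [a0 h]] := cf x eps e0.
exists a => // y hy; case: (Req_dec x y) => [->|nxy].
  by rewrite Rminus_diag Rabs_R0.
by apply: (h y); split.
Qed.

Lemma continuous_apart_local (f g : R -> R) u v :
  continuity f -> continuity g -> f u <> g v ->
  exists a : posreal, forall x y,
    Rlt (Rabs (x - u)) a -> Rlt (Rabs (y - v)) a ->
    Rle a (Rabs (f x - g y)).
Proof.
move=> cf cg neq; set eta := Rabs (f u - g v).
have eta0 : Rlt R0 eta by apply: Rabs_pos_lt; lra.
have eta4 : Rlt R0 (eta / 4) by lra.
have [a a0 ha] := continuity_ball u cf eta4.
have [b b0 hb] := continuity_ball v cg eta4.
have c0 : Rlt R0 (Rmin (Rmin a b) (eta / 4)) by do ?apply: Rmin_glb_lt.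
exists (mkposreal _ c0) => x y /= hx hy.
have := Rmin_l (Rmin a b) (eta / 4); have := Rmin_r (Rmin a b) (eta / 4).
have := Rmin_l a b; have := Rmin_r a b.
move: hx hy; move: (Rmin (Rmin a b) (eta / 4)) => c.
move: (Rmin a b) => c' hx hy ? ? ? ?.
have {}hx : Rlt (Rabs (x - u)) a by lra.
have {}hy : Rlt (Rabs (y - v)) b by lra.
have := ha _ hx; have := hb _ hy.
have T1 := Rabs_triang (f x - g y) (- (f x - f u) + (g y - g v)).
have T2 := Rabs_triang (- (f x - f u)) (g y - g v).
move: T1 T2; rewrite Rabs_Ropp.
have -> : (f x - g y + (- (f x - f u) + (g y - g v)) = f u - g v)%Re by ring.
rewrite -/eta; lra.
Qed.

(** Each pair of parameters has a neighbourhood with its own bound; compactness of the unit square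
    makes the bound uniform. *)
Lemma disjoint_curves_far (f g : R -> R * R) :
  continuous2 f -> continuous2 g ->
  (forall s t, in01 s -> in01 t -> f s <> g t) ->
  exists2 d, Rlt R0 d & forall s t, in01 s -> in01 t -> far d (f s) (g t).
Proof.
move=> [cf1 cf2] [cg1 cg2] dis.
have loc u v : exists a : posreal, in01 u -> in01 v -> forall x y,
    Rlt (Rabs (x - u)) a -> Rlt (Rabs (y - v)) a -> far a (f x) (g y).
  case: (classic (in01 u /\ in01 v)) => [[hu hv]|n]; last first.
    by exists (mkposreal 1 Rlt_0_1) => hu hv; case: n.
  case: (Req_dec (f u).1 (g v).1) => [e1|n1]; last first.
    have [a ha] := continuous_apart_local cf1 cg1 n1.
    by exists a => _ _ x y hx hy; left; apply: ha.
  have n2 : (f u).2 <> (g v).2.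
    move=> e2; apply: (dis u v hu hv).
    by rewrite (surjective_pairing (f u)) (surjective_pairing (g v)) e1 e2.
  have [a ha] := continuous_apart_local cf2 cg2 n2.
  by exists a => _ _ x y hx hy; right; apply: ha.
pose delta u v := proj1_sig (constructive_indefinite_description _ (loc u v)).
have hdelta u v := proj2_sig (constructive_indefinite_description _ (loc u v)).
(* [delta] serves as a gauge. Compactness yields the nearby centre only under a double negation,
   hence [NNPP] below. *)
have [d hd] := Compactness.compactness_value_2d 0 1 0 1 delta.
exists d; first exact: cond_pos.
move=> s t hs ht; apply: NNPP => nf; apply: (hd s t hs ht).
case=> u [v [hu [hv [hsu [htv le]]]]]; apply: nf.
have := hdelta u v hu hv s t hsu htv; rewrite -/(delta u v) /far.
case=> ?; [left | right]; exact: Rle_trans le _.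
Qed.

Lemma common_lower_bound (I : finType) (P : I -> R -> Prop) :
  (forall i d d', Rlt R0 d' -> Rle d' d -> P i d -> P i d') ->
  (forall i, exists2 d, Rlt R0 d & P i d) ->
  exists2 d, Rlt R0 d & forall i, P i d.
Proof.
move=> mono ex.
suff [d d0 h] : exists2 d, Rlt R0 d & forall i, i \in enum I -> P i d.
  by exists d => // i; apply: h; rewrite mem_enum.
elim: (enum I) => [|i s [d d0 IH]]; first by exists R1 => //; apply: Rlt_0_1.
have [c c0 hc] := ex i; have m0 : Rlt R0 (Rmin c d) by apply: Rmin_glb_lt.
exists (Rmin c d) => // j; rewrite inE => /orP [/eqP->|/IH].
  by apply: mono hc => //; apply: Rmin_l.
by apply: mono => //; apply: Rmin_r.
Qed.

Lemma curve_uniform (f : R -> R * R) eps : continuous2 f -> Rlt R0 eps ->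
  exists2 d, Rlt R0 d & forall s t, in01 s -> in01 t ->
    Rlt (Rabs (s - t)) d -> near eps (f s) (f t).
Proof.
move=> [c1 c2] e0.
have [d1 h1] := @Heine_cor2 _ 0 1 (fun x _ => c1 x) (mkposreal _ e0).
have [d2 h2] := @Heine_cor2 _ 0 1 (fun x _ => c2 x) (mkposreal _ e0).
exists (Rmin d1 d2); first by apply: Rmin_glb_lt; apply: cond_pos.
move=> s t hs ht h; split.
  by apply: h1 => //; apply: Rlt_le_trans h _; apply: Rmin_l.
by apply: h2 => //; apply: Rlt_le_trans h _; apply: Rmin_r.
Qed.

(** * Sampling the arcs of a drawing *)

Section PlaneDrawing.

Variables (V : finType) (e : rel V).
Variables (pos : V -> R * R) (arc : V -> V -> R -> R * R).
Hypothesis pos_inj : injective pos.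
Hypothesis arcP : forall x y, e x y ->
   continuity (fun t => fst (arc x y t)) /\
   continuity (fun t => snd (arc x y t)) /\
   arc x y R0 = pos x /\ arc x y R1 = pos y /\
   (forall s t, in01 s -> in01 t -> arc x y s = arc x y t -> s = t) /\
   (forall z s, in01o s -> arc x y s <> pos z).
Hypothesis arc_disjoint : forall x y u w, e x y -> e u w ->
   ~ ((x == u) && (y == w) || (x == w) && (y == u)) ->
   forall s t, in01o s -> in01o t -> arc x y s <> arc u w t.

Lemma in01_cases t : in01 t -> [\/ t = R0, t = R1 | in01o t].
Proof.
case=> h0 h1; case: (Req_dec t 0) => [->|n0]; first by constructor 1.
case: (Req_dec t 1) => [->|n1]; first by constructor 2.
by constructor 3; split; lra.
Qed.

Lemma independent_arcs_disjoint x y u w : e x y -> e u w ->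
  x != u -> x != w -> y != u -> y != w ->
  forall s t, in01 s -> in01 t -> arc x y s <> arc u w t.
Proof.
move=> exy euw xu xw yu yw s t.
have [_ [_ [a0 [a1 [_ az]]]]] := arcP exy.
have [_ [_ [b0 [b1 [_ bz]]]]] := arcP euw.
move=> /in01_cases [->|->|hs] /in01_cases [->|->|ht]; rewrite ?a0 ?a1 ?b0 ?b1.
- by move/pos_inj/eqP; apply/negP.
- by move/pos_inj/eqP; apply/negP.
- by move/esym; apply: bz.
- by move/pos_inj/eqP; apply/negP.
- by move/pos_inj/eqP; apply/negP.
- by move/esym; apply: bz.
- exact: az.
- exact: az.
apply: arc_disjoint => //.
by rewrite (negbTE xu) (negbTE xw).
Qed.

(** There are finitely many edges, so one distance [d] separates all independent arcs, and [N]
    samples per arc make all steps shorter than [d / 4]. *)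
Lemma sampling_scale : exists d N,
  [/\ Rlt R0 d, 0 < N,
    forall x y u w, e x y -> e u w ->
      x != u -> x != w -> y != u -> y != w ->
      forall s t, in01 s -> in01 t -> far d (arc x y s) (arc u w t)
  & forall x y, e x y -> forall s t, in01 s -> in01 t ->
      Rle (Rabs (s - t)) (/ INR N) -> near (d / 4) (arc x y s) (arc x y t)].
Proof.
have arc_cont x y : e x y -> continuous2 (arc x y).
  by move=> /arcP [c1 [c2 _]]; split.
have [||d d0 hd] := @common_lower_bound _
  (fun q : V * V * (V * V) => fun d => e q.1.1 q.1.2 -> e q.2.1 q.2.2 ->
      q.1.1 != q.2.1 -> q.1.1 != q.2.2 -> q.1.2 != q.2.1 -> q.1.2 != q.2.2 ->
      forall s t, in01 s -> in01 t ->
        far d (arc q.1.1 q.1.2 s) (arc q.2.1 q.2.2 t)).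
- move=> q c c' _ le h h1 h2 h3 h4 h5 h6 s t hs ht.
  by case: (h h1 h2 h3 h4 h5 h6 s t hs ht) => ?; [left | right]; lra.
- move=> [[x y] [u w]] /=.
  case: (classic [/\ e x y, e u w, x != u & [/\ x != w, y != u & y != w]]); last first.
    move=> n; exists R1; first exact: Rlt_0_1.
    by move=> *; case: n.
  move=> [exy euw xu [xw yu yw]].
  have [c c0 hc] := disjoint_curves_far (arc_cont _ _ exy) (arc_cont _ _ euw)
    (independent_arcs_disjoint exy euw xu xw yu yw).
  by exists c.
have d4 : Rlt R0 (d / 4) by lra.
have [||c c0 hc] := @common_lower_bound _
  (fun q : V * V => fun c => e q.1 q.2 -> forall s t, in01 s -> in01 t ->
     Rlt (Rabs (s - t)) c -> near (d / 4) (arc q.1 q.2 s) (arc q.1 q.2 t)).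
- by move=> q c c' _ le h hq s t hs ht hst; apply: h => //; lra.
- move=> [x y] /=; case exy: (e x y); last by exists R1 => //; apply: Rlt_0_1.
  have [c c0 hc] := curve_uniform (arc_cont _ _ exy) d4.
  by exists c => // _.
have [N [hN N0]] := archimed_cor1 c c0.
exists d, N; split=> //.
- exact/ltP.
- by move=> x y u w exy euw; apply: (hd ((x, y), (u, w))).
- move=> x y exy s t hs ht h; apply: (hc (x, y)) => //; lra.
Qed.

Section Walks.

Variables (d : R) (N : nat).
Hypothesis N_gt0 : 0 < N.
Hypothesis far_arcs : forall x y u w, e x y -> e u w ->
  x != u -> x != w -> y != u -> y != w ->
  forall s t, in01 s -> in01 t -> far d (arc x y s) (arc u w t).
Hypothesis near_arcs : forall x y, e x y -> forall s t, in01 s -> in01 t ->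
  Rle (Rabs (s - t)) (/ INR N) -> near (d / 4) (arc x y s) (arc x y t).

(** The quotient of [k] by [N] selects the edge and the remainder the sample on it; from
    [size p * N] on, the point stays at the last vertex. *)
Definition walk_point (x : V) (p : seq V) (k : nat) : R * R :=
  if k %/ N < size p
  then arc (nth x (x :: p) (k %/ N)) (nth x p (k %/ N)) (INR (k %% N) / INR N)
  else pos (last x p).

Lemma INR_N_gt0 : Rlt R0 (INR N).
Proof. exact/lt_0_INR/ltP. Qed.

Lemma in01_frac i : i <= N -> in01 (INR i / INR N).
Proof.
move=> le; have N0 := INR_N_gt0; split.
  apply: Rmult_le_pos; first exact: pos_INR.
  exact/Rlt_le/Rinv_0_lt_compat.
apply: (Rmult_le_reg_r (INR N)) => //.
rewrite /Rdiv Rmult_assoc Rinv_l; last lra.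
rewrite Rmult_1_r Rmult_1_l; exact/le_INR/leP.
Qed.

Lemma walk_edge x p i : path e x p -> i < size p ->
  e (nth x (x :: p) i) (nth x p i).
Proof. by move/(pathP x); apply. Qed.

Lemma walk_point0 x p : path e x p -> walk_point x p 0 = pos x.
Proof.
rewrite /walk_point div0n mod0n; case: p => [|y p] //= /andP [exy _].
have -> : (0 / INR N = 0)%Re by field; have := INR_N_gt0; lra.
by have [_ [_ [-> _]]] := arcP exy.
Qed.

Lemma walk_point_last x p : walk_point x p (size p * N) = pos (last x p).
Proof. by rewrite /walk_point mulnK // ltnn. Qed.

Lemma walk_point_on x p k : path e x p -> p != [::] -> exists u w t,
  [/\ e u w, u \in x :: p, w \in x :: p, in01 t & walk_point x p k = arc u w t].
Proof.
move=> hp; rewrite /walk_point; case: ltnP => [lt _|_].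
  exists (nth x (x :: p) (k %/ N)), (nth x p (k %/ N)), (INR (k %% N) / INR N)%Re.
  split=> //.
  - exact: walk_edge.
  - by apply: mem_nth; rewrite /= ltnS ltnW.
  - by rewrite inE mem_nth ?orbT.
  - apply: in01_frac; exact/ltnW/ltn_pmod.
case/lastP: p hp => // p y; rewrite rcons_path last_rcons => /andP [hp exy] _.
exists (last x p), y, R1; split=> //.
- by rewrite -rcons_cons mem_rcons inE mem_last orbT.
- by rewrite -rcons_cons mem_rcons inE eqxx.
- by split; lra.
- by have [_ [_ [_ [->]]]] := arcP exy.
Qed.

Lemma walk_point_fine x p : path e x p ->
  fine d (walk_point x p) (size p * N).
Proof.
move=> hp k lt.
have N0 := INR_N_gt0.
have lq : k %/ N < size p by rewrite ltn_divLR.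
have exy := walk_edge hp lq.
have lr : k %% N < N by rewrite ltn_pmod.
(* The next sample is on the same arc even if its parameter is 1: it is then also the start of the
   next arc, or the end of the walk. *)
have -> : walk_point x p k.+1 =
  arc (nth x (x :: p) (k %/ N)) (nth x p (k %/ N)) (INR (k %% N).+1 / INR N).
  rewrite /walk_point; case: (ltnP (k %% N).+1 N) => lrN.
    have E : k.+1 = k %/ N * N + (k %% N).+1 by rewrite addnS -divn_eq.
    have -> : k.+1 %/ N = k %/ N.
      by rewrite {1}E divnMDl // (divn_small lrN) addn0.
    have -> : k.+1 %% N = (k %% N).+1 by rewrite {1}E modnMDl modn_small.
    by rewrite lq.
  have EN : (k %% N).+1 = N by apply/eqP; rewrite eqn_leq lrN lr.
  have E : k.+1 = (k %/ N).+1 * N.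
    by rewrite {1}(divn_eq k N) -addnS EN addnC mulSn.
  rewrite E mulnK // modnMl EN.
  have -> : (INR N / INR N = 1)%Re by field; lra.
  have -> : (INR 0 / INR N = 0)%Re by rewrite /=; field; lra.
  have [_ [_ [_ [-> _]]]] := arcP exy.
  case: ltnP => lq'.
    by have [_ [_ [-> _]]] := arcP (walk_edge hp lq').
  have Es : size p = (k %/ N).+1 by apply/eqP; rewrite eqn_leq lq lq'.
  by rewrite (last_nth x) Es.
rewrite /walk_point lq; apply: near_arcs => //.
- exact/in01_frac/ltnW.
- exact: in01_frac.
rewrite S_INR.
have -> : (INR (k %% N) / INR N - (INR (k %% N) + 1) / INR N = - / INR N)%Re.
  by field; lra.
rewrite Rabs_Ropp Rabs_pos_eq; first lra.
exact/Rlt_le/Rinv_0_lt_compat.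
Qed.

Lemma walks_apart x p y q : path e x p -> path e y q ->
  p != [::] -> q != [::] -> [disjoint x :: p & y :: q] ->
  forall m n, apart d (walk_point x p) m (walk_point y q) n.
Proof.
move=> hp hq np nq dis m n i j _ _.
have [u [w [s [euw up wp hs ->]]]] := walk_point_on i hp np.
have [u' [w' [t [euw' uq wq ht ->]]]] := walk_point_on j hq nq.
have ne a b : a \in x :: p -> b \in y :: q -> a != b.
  by move=> ap bq; apply/eqP=> E; move: (disjointFr dis ap); rewrite E bq.
by apply: far_arcs => //; apply: ne.
Qed.

End Walks.

End PlaneDrawing.

(* Only walks without a common branch vertex have to be disjoint, and walks may
   repeat vertices. *)
Lemma planar_no_K33_walks (V : finType) (e : rel V) (a b : 'I_3 -> V)
    (W : 'I_3 -> 'I_3 -> seq V) : planar e ->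
  (forall i j, [/\ path e (a i) (W i j), last (a i) (W i j) = b j
                 & W i j != [::]]) ->
  ~ (forall i j k l, i != k -> j != l ->
       [disjoint a i :: W i j & a k :: W k l]).
Proof.
move=> [pos [arc [pi [ap ad]]]] hW dis.
have [d [N [d0 N0 hfar hnear]]] := sampling_scale pi ap ad.
apply: (@K33_no_drawing d d0 (pos \o a) (pos \o b)
  (fun i j => walk_point pos arc N (a i) (W i j)) (fun i j => size (W i j) * N)).
- by move=> i j; apply: (walk_point0 ap); case: (hW i j).
- by move=> i j; rewrite walk_point_last //=; case: (hW i j) => _ ->.
- by move=> i j; apply: (walk_point_fine ap N0 hnear); case: (hW i j).
move=> i j k l ik jl.
have [h1 _ h2] := hW i j; have [h3 _ h4] := hW k l.
by apply: (walks_apart ap N0 hfar h1 h3 h2 h4); apply: dis.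
Qed.

(** * Theta graphs touched by a connected set *)

Definition restr (V : finType) (e : rel V) (A : {set V}) : rel V :=
  [rel x y | [&& e x y, x \in A & y \in A]].

Lemma restr_path (V : finType) (e : rel V) (A : {set V}) x p :
  path (restr e A) x p -> path e x p /\ {subset p <= A}.
Proof.
elim: p x => //= y p IH x /andP [/and3P [-> _ yA] /IH [-> sub]]; split=> //.
by move=> z; rewrite inE => /orP [/eqP-> | /sub].
Qed.

(* Contracting [A] to a point would give K_{3,3}, with [A], [s], [t] against
   the three contact points. *)
Lemma planar_theta (V : finType) (e : rel V) (s t : V) (Y : 'I_3 -> seq V)
    (A : {set V}) :
  symmetric e -> planar e ->
  (forall k, path e s (rcons (Y k) t)) -> s != t ->
  (forall k, [/\ s \notin Y k, t \notin Y k & {in Y k, forall z, z \notin A}]) ->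
  (forall k l, k != l -> {in Y k, forall z, z \notin Y l}) ->
  s \notin A -> t \notin A ->
  {in A &, forall x y, connect (restr e A) x y} ->
  ~ (forall k, exists x y, [/\ x \in A, y \in Y k & e x y]).
Proof.
move=> esym pl hY st hst dY sA tA cA touch.
have [r [_ [rA _ _]]] := touch ord0.
have ex k : exists q : seq V * V * seq V * seq V,
   (* The components of [q] are, in order, the part of [Y k] before the contact vertex, that vertex,
      the part after it, and a path inside [A] leading from [r] to a neighbour of it. *)
   [/\ Y k = q.1.1.1 ++ q.1.1.2 :: q.1.2, path e r (rcons q.2 q.1.1.2)
     & {subset q.2 <= A}].
  have [x [y [xA yY exy]]] := touch k.
  have /connectP [p /restr_path [hp pA] lastp] := cA _ _ rA xA.
  case/splitPr: yY => Ya Yb; exists (Ya, y, Yb, p); split=> //=.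
  by rewrite rcons_path hp -lastp.
have [q hq] := fin_all_exists ex => {ex}.
pose a (i : 'I_3) := nth r [:: r; s; t] i.
pose b k := (q k).1.1.2.
pose W (i k : 'I_3) :=
  rcons (nth [::] [:: (q k).2; (q k).1.1.1; rev (q k).1.2] i) (b k).
(* Each walk [W i k] stays in the union of [B i] and [Y k]; disjointness of the walks reduces to
   that of these sets. *)
pose B (i : 'I_3) := nth A [:: A; [set s]; [set t]] i.
apply: (@planar_no_K33_walks V e a b W pl).
  move=> i k; have [Yk pk _] := hq k.
  split; [| by rewrite last_rcons | by rewrite /W; case: (nth _ _ _)].
  have := hY k; rewrite Yk rcons_cat rcons_cons cat_path => /andP [p1 /= /andP [p2 p3]].
  case: i => [[|[|[|//]]]] lt /=.
  - exact: pk.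
  - by rewrite /a /W /= rcons_path p1.
  rewrite /a /W /= -rev_cons.
  have := rev_path e (b k) (rcons (q k).1.2 t).
  rewrite last_rcons belast_rcons => ->.
  by rewrite (@eq_path _ _ e) // => x y /=; rewrite esym.
have sub i k z : z \in a i :: W i k -> (z \in B i) || (z \in Y k).
  have [Yk pk wA] := hq k.
  rewrite /W -rcons_cons mem_rcons inE => /orP [/eqP->|].
    by rewrite Yk mem_cat inE eqxx !orbT.
  case: i => [[|[|[|//]]]] lt /=; rewrite inE /B /a /= ?inE => /orP [/eqP->|].
  - by rewrite rA.
  - by move/wA->.
  - by rewrite eqxx.
  - by rewrite Yk mem_cat => ->; rewrite !orbT.
  - by rewrite eqxx.
  - by rewrite mem_rev Yk mem_cat inE => ->; rewrite !orbT.
have BY i k z : z \in B i -> z \in Y k -> False.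
  have [sY tY YA] := hst k.
  case: i => [[|[|[|//]]]] lt /=; rewrite /B /= ?inE.
  - by move=> zA /YA; rewrite zA.
  - by move/eqP->; apply/negP.
  - by move/eqP->; apply/negP.
have BB i k z : i != k -> z \in B i -> z \in B k -> False.
  case: i k => [[|[|[|//]]]] lt [[|[|[|//]]]] lt' //= _; rewrite /B /= ?inE.
  - by move=> zA /eqP E; move: sA; rewrite -E zA.
  - by move=> zA /eqP E; move: tA; rewrite -E zA.
  - by move/eqP-> => zA; rewrite zA in sA.
  - by move/eqP-> => E; rewrite E in st.
  - by move/eqP-> => zA; rewrite zA in tA.
  - by move/eqP->; rewrite eq_sym => E; rewrite E in st.
move=> i j k l ik jl; rewrite disjoint_has; apply/hasPn=> z /sub h1.
apply/negP=> /sub; case/orP: h1 => h1 /orP [] h2.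
- exact: BB h1 h2.
- exact: BY h1 h2.
- exact: BY h2 h1.
- by move: (dY _ _ jl _ h1); rewrite h2.
Qed.

(** * The game on a bipartite planar graph *)

Section Game.

Variables (V : finType) (e : rel V).

Local Notation adj := (adjr e).
Local Notation cwin := (cops_win e).

(* The cops have just moved and the robber is about to move. *)
Definition rwin (cs : seq V) (r : V) : Prop :=
  forall r', adj r r' -> cwin (rem r' cs) r'.

Lemma adjr_refl x : adj x x.
Proof. by rewrite /adjr eqxx. Qed.

(** The recursive occurrence of [cops_win] is nested inside a disjunction; this principle supplies
    the induction hypothesis there. *)
Lemma cops_win_ind_nested (P : seq V -> V -> Prop) :
  (forall cs r cs', all2 adj cs cs' ->
     (r \in cs' \/ forall r', adj r r' -> P (rem r' cs') r') -> P cs r) ->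
  forall cs r, cwin cs r -> P cs r.
Proof.
move=> step; fix IH 3 => cs r [{}cs {}r cs' mv next].
apply: step mv _; case: next => [h|h]; [by left | right => r' h'].
exact/IH/h.
Qed.

Lemma all2_nth (T : Type) (rl : rel T) x0 s t : all2 rl s t ->
  size s = size t /\ forall i, i < size s -> rl (nth x0 s i) (nth x0 t i).
Proof.
elim: s t => [|x s IH] [|y t] //= /andP [h /IH [-> h']]; split=> // -[|i] //.
exact: h'.
Qed.

Lemma all2_perm (T : eqType) (rl : rel T) s s' t : perm_eq s s' ->
  all2 rl s t -> exists2 t', perm_eq t t' & all2 rl s' t'.
Proof.
case: s => [|x0 s]; first by rewrite perm_sym => /perm_nilP ->; case: t => // _; exists [::].
move: (x0 :: s) => {}s /[dup] ps; rewrite perm_sym => /(perm_iotaP x0) [Is pI ->].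
move=> /(all2_nth x0) [sz h]; exists [seq nth x0 t i | i <- Is].
  rewrite perm_sym; apply/(perm_iotaP x0); exists Is => //.
  by rewrite -sz.
have : {subset Is <= iota 0 (size s)} by move=> i; rewrite (perm_mem pI).
elim: Is {ps pI} => //= i Is IH sub; rewrite IH ?andbT.
  by apply: h; have := sub i; rewrite inE eqxx mem_iota => /(_ isT).
by move=> j hj; apply: sub; rewrite inE hj orbT.
Qed.

Lemma perm_rem (T : eqType) (x : T) s t :
  perm_eq s t -> perm_eq (rem x s) (rem x t).
Proof.
move=> st; have [xs|xs] := boolP (x \in s); last first.
  by rewrite !rem_id // -(perm_mem st).
rewrite -(perm_cons x) -(permPl (perm_to_rem xs)).
by rewrite -(permPr (perm_to_rem _)) // -(perm_mem st).
Qed.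

Lemma cops_win_perm cs1 cs2 r : perm_eq cs1 cs2 -> cwin cs1 r -> cwin cs2 r.
Proof.
move=> h w; move: cs1 r w cs2 h.
apply: cops_win_ind_nested => cs r cs' mv next cs2 pe.
have [cs2' pe' mv'] := all2_perm pe mv.
apply: (CopsWin mv'); case: next => next.
  by left; rewrite -(perm_mem pe').
by right=> r' h; apply: next h _ _; apply: perm_rem.
Qed.

Lemma rwin_perm cs1 cs2 r : perm_eq cs1 cs2 -> rwin cs1 r -> rwin cs2 r.
Proof.
move=> pe h r' a; apply: cops_win_perm (h r' a); exact: perm_rem.
Qed.

Lemma capture cs c r : c \in cs -> adj c r -> cwin cs r.
Proof.
move=> ccs cr; apply: (@CopsWin _ _ _ _ [seq if x == c then r else x | x <- cs]).
  elim: cs {ccs} => //= x cs ->; rewrite andbT; case: eqP => [->|] //.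
  by rewrite adjr_refl.
by left; apply/mapP; exists c; rewrite ?eqxx.
Qed.

Lemma mem_rem_neq (T : eqType) (x y : T) s : x != y -> x \in s -> x \in rem y s.
Proof.
move=> xy; elim: s => //= z s IH; rewrite inE.
case: (eqVneq z y) => [->|_]; first by rewrite (negbTE xy).
by rewrite inE => /orP [->|/IH ->] //; rewrite orbT.
Qed.

(** * Guards, territories and the moves of the free cops *)

Hypothesis esym : symmetric e.
Variable col : V -> bool.
Hypothesis colP : forall x y, e x y -> col x != col y.

Lemma eirr x : e x x = false.
Proof. by apply/negP=> /colP; rewrite eqxx. Qed.

(* [rho] folds the territory [R] onto the core [K], fixing the vertices of [A]
   adjacent to [R].  A cop standing on the image of the robber has the robber's
   colour, hence cannot be attacked, and captures the robber entering [A]. *)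
Definition guard (R K : {set V}) (rho : V -> V) (A : seq V) : Prop :=
  [/\ {in R &, forall x y, e x y -> e (rho x) (rho y)},
      {in R, forall x, {in A, forall y, e x y -> e (rho x) y}},
      {in R, forall x, rho x \in K}
    & {in R, forall x, col (rho x) = col x}].

Definition conn (A : {set V}) : Prop :=
  {in A &, forall x y, connect (restr e A) x y}.

(** The free cops walk in [K], which is connected and out of reach for a robber staying in the
    territory [R]; the robber can leave [R] only through [A ++ B]. *)
Definition arena (R K : {set V}) r1 A r2 B : Prop :=
  [/\ conn R, conn K, {in K, forall x, x \notin R},
      guard R K r1 A /\ guard R K r2 B
    & {in R, forall x y, y \notin R -> e x y -> y \in A ++ B}].

(* [idx] gives the position on the path [s :: q] of the shadow of a vertex. *)
Definition shadow (R : {set V}) (s : V) (q : seq V) (idx : V -> nat) : Prop :=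
  let rho x := nth s (s :: q) (idx x) in
  [/\ path e s q, forall x, idx x <= size q,
      {in R &, forall x y, e x y -> e (rho x) (rho y) /\ idx y <= (idx x).+1},
      {in R, forall x, {in s :: q, forall y, e x y -> e (rho x) y}}
    & {in R, forall x, col (rho x) = col x /\ (x \in q -> rho x = x)}].

Section Step.

Variables (R K : {set V}) (r1 r2 : V -> V) (A B : seq V).
Hypothesis ar : arena R K r1 A r2 B.

(** The guard of the exit is adjacent to it, and has the colour of [x] rather than that of [y], so
    he is not the cop removed by an attack on [y]. *)
Lemma escape_caught x y cs : x \in R -> y \notin R -> adj x y ->
  r1 x \in cs -> r2 x \in cs -> cwin (rem y cs) y.
Proof.
case: ar => _ _ _ [[_ g1 _ c1] [_ g2 _ c2]] cover xR yR.
rewrite /adjr; case/orP => [/eqP E|exy]; first by rewrite -E xR in yR.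
move=> m1 m2.
have := cover x xR y yR exy; rewrite mem_cat => /orP [yA|yB].
  apply: (@capture _ (r1 x)); last by rewrite /adjr g1 ?orbT.
  apply: mem_rem_neq => //; apply/eqP=> E; move: (colP exy).
  by rewrite -E c1 // eqxx.
apply: (@capture _ (r2 x)); last by rewrite /adjr g2 ?orbT.
apply: mem_rem_neq => //; apply/eqP=> E; move: (colP exy).
by rewrite -E c2 // eqxx.
Qed.

Lemma guard_follow rho C x y : guard R K rho C -> x \in R -> y \in R ->
  adj x y -> adj (rho x) (rho y).
Proof.
move=> [g _ _ _] xR yR; rewrite /adjr => /orP [/eqP->|h]; first by rewrite eqxx.
by rewrite g ?orbT.
Qed.

(** Free cops in [K] cannot be attacked from [R]; if they stand together, an attack costs one of
    them and the other captures. So only robber moves within [R] remain to be answered. *)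
Lemma round r c1 c2 : r \in R -> (c1 = c2 \/ (c1 \in K /\ c2 \in K)) ->
  (forall r', r' \in R -> adj r r' -> exists c1' c2',
     [/\ adj c1 c1', adj c2 c2'
       & r' = c1' \/ rwin [:: r1 r'; r2 r'; c1'; c2'] r']) ->
  rwin [:: r1 r; r2 r; c1; c2] r.
Proof.
move=> rR hc next r' rr'.
have [_ _ KR [g1 g2] _] := ar.
have [r'R|r'R] := boolP (r' \in R); last first.
  by apply: escape_caught rR r'R rr' _ _; rewrite !inE eqxx ?orbT.
have nK z : z \in K -> (r' == z) = false.
  by move=> zK; apply/eqP=> E; move: (KR z zK); rewrite -E r'R.
have n1 : (r' == r1 r) = false by apply: nK; case: g1 => _ _ h _; apply: h.
have n2 : (r' == r2 r) = false by apply: nK; case: g2 => _ _ h _; apply: h.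
have [E|n] := boolP (r' \in [:: c1; c2]).
  case: hc => [cc|[cK1 cK2]]; last by move: E; rewrite !inE !nK.
  subst c2; move: E; rewrite !inE orbb => /eqP E; subst c1.
  apply: (@capture _ r'); rewrite ?adjr_refl //=.
  by rewrite ![_ == r']eq_sym n1 n2 eqxx !inE eqxx !orbT.
rewrite rem_id; last by move: n; rewrite !inE n1 n2.
have [c1' [c2' [a1 a2 h]]] := next r' r'R rr'.
apply: (@CopsWin _ _ _ _ [:: r1 r'; r2 r'; c1'; c2']).
  by rewrite /= a1 a2 (guard_follow g1) // (guard_follow g2).
by case: h => [->|h]; [left; rewrite !inE eqxx !orbT | right].
Qed.

(** Since [K] is connected, the free cops can walk to [s] inside it, one after the other, without
    exposure to attack. *)
Lemma gather s f1 f2 : s \in K -> f1 \in K -> f2 \in K ->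
  {in R, forall r, rwin [:: r1 r; r2 r; s; s] r} ->
  {in R, forall r, rwin [:: r1 r; r2 r; f1; f2] r}.
Proof.
move=> sK f1K f2K base; have [_ cK _ _ _] := ar.
have {base} base : {in R, forall r, rwin [:: r1 r; r2 r; s; f2] r}.
  have /connectP [p hp last2] := cK _ _ f2K sK.
  elim: p f2 f2K hp last2 => [|y p IH] f2 f2K /=; first by move=> _ <-.
  move=> /andP [/and3P [ey _ yK] hp] last2 r rR.
  apply: round => // [|r' r'R _]; first by right.
  exists s, y; rewrite adjr_refl; split=> //; first by rewrite /adjr ey orbT.
  by right; apply: (IH y).
have /connectP [p hp last1] := cK _ _ f1K sK.
elim: p f1 f1K hp last1 => [|y p IH] f1 f1K /=; first by move=> _ <-.
move=> /andP [/and3P [ey _ yK] hp] last1 r rR.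
apply: round => // [|r' r'R _]; first by right.
exists y, f2; rewrite adjr_refl; split=> //; first by rewrite /adjr ey orbT.
by right; apply: (IH y).
Qed.

(* The two free cops walk together from one end of the path, so that attacking
   one of them is suicidal, and meet the shadow because it moves by at most one
   position per round. *)
Lemma march s q idx : s \in K -> shadow R s q idx ->
  let rho x := nth s (s :: q) (idx x) in
  {in R, forall r, r <> rho r -> rwin [:: r1 r; r2 r; rho r; rho r] r} ->
  {in R, forall r, rwin [:: r1 r; r2 r; s; s] r}.
Proof.
move=> sK [pq idx_le hom _ _] rho win.
pose c k := nth s (s :: q) k.
have adjc k : k < size q -> adj (c k) (c k.+1).
  by move=> lt; rewrite /adjr (pathP s pq) ?orbT.
(* Invariant: the cops stand at position [k], the shadow is at [k] or further, and [n] positions are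
   left. Once the positions agree, [win] applies. *)
suff H n k r : r \in R -> k + n = size q -> k <= idx r -> r <> c k ->
    rwin [:: r1 r; r2 r; c k; c k] r.
  move=> r rR; apply: (H (size q) 0) => // E.
  by have [_ _ KR _ _] := ar; move: (KR s sK); rewrite -[s]E rR.
elim: n k r => [|n IH] k r rR kn ki rc.
  have E : idx r = k by apply/eqP; rewrite eqn_leq ki -[k]addn0 kn idx_le.
  by have := win r rR; rewrite /rho E; apply.
have [E|lt] : idx r = k \/ k < idx r.
  by move: ki; rewrite leq_eqVlt => /orP [/eqP->|]; [left | right].
  by have := win r rR; rewrite /rho E; apply.
apply: round => // [|r' r'R rr']; first by left.
have ki' : k <= idx r'.
  move: rr'; rewrite /adjr => /orP [/eqP<-//|].
  by rewrite esym => /(hom _ _ r'R rR) [_]; lia.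
(* If the shadow comes back to position [k], the cops wait for it; otherwise they advance
   together. *)
have [E|lt'] : idx r' = k \/ k < idx r'.
  by move: ki'; rewrite leq_eqVlt => /orP [/eqP->|]; [left | right].
  exists (c k), (c k); rewrite adjr_refl; split=> //.
  case: (eqVneq r' (c k)) => [|/eqP n']; [by left | right].
  by have := win r' r'R; rewrite /rho E; apply.
exists (c k.+1), (c k.+1); rewrite adjc; last by lia.
split=> //; case: (eqVneq r' (c k.+1)) => [|/eqP n']; [by left | right].
by apply: IH => //; lia.
Qed.

End Step.

(** Only vertices with a neighbour in [R'] are constrained, so the new list [A'] may be prolonged by
    vertices that the robber cannot reach in one move. *)
Lemma guard_mono (R R' K K' : {set V}) rho A A' : guard R K rho A ->
  R' \subset R -> K \subset K' ->
  (forall x y, x \in R' -> y \in A' -> e x y -> y \in A) ->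
  guard R' K' rho A'.
Proof.
move=> [g1 g2 g3 g4] /subsetP sR /subsetP sK sA; split.
- by move=> x y /sR xR /sR yR; apply: g1.
- by move=> x xR y yA exy; apply: g2 => //; [apply: sR | apply: sA exy].
- by move=> x /sR xR; apply/sK/g3.
- by move=> x /sR xR; apply: g4.
Qed.

Lemma restr_sym (A : {set V}) : symmetric (restr e A).
Proof. by move=> x y; rewrite /restr /= esym [(x \in A) && _]andbC. Qed.

Lemma restr_mono (A B : {set V}) x y :
  A \subset B -> connect (restr e A) x y -> connect (restr e B) x y.
Proof.
move/subsetP=> sub; apply: connect_sub => u v /and3P [h uA vA].
by apply: connect1; rewrite /restr /= h !sub.
Qed.

Lemma conn_extend (K : {set V}) s q : conn K -> s \in K -> path e s q ->
  conn (K :|: [set z in q]).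
Proof.
move=> cK sK pq; set K' := _ :|: _.
have KK' : K \subset K' by apply: subsetUl.
suff H x : x \in K' -> connect (restr e K') s x.
  move=> x y xK yK; apply: connect_trans (H _ yK).
  by rewrite (sym_connect_sym (@restr_sym _)) H.
rewrite inE => /orP [xK|]; first exact: restr_mono KK' (cK _ _ sK xK).
rewrite inE => /splitPr xq; case: xq pq @K' KK' => p1 p2 pq K' KK'.
apply/connectP; exists (rcons p1 x); last by rewrite last_rcons.
have sub : {subset s :: rcons p1 x <= K'}.
  move=> z; rewrite !inE mem_rcons mem_cat !inE => /or3P [/eqP->|/eqP->|->].
  - by rewrite sK.
  - by rewrite eqxx !orbT.
  - by rewrite orbT.
move: pq; rewrite cat_path /= => /and3P [h1 h2 _].
have : path e s (rcons p1 x) by rewrite rcons_path h1.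
elim: (rcons p1 x) s sub {h1 h2 sK} => //= y p IH u sub /andP [h1 h2].
rewrite /restr /= h1 !sub ?inE ?eqxx ?orbT //=; apply: IH => // z zp.
by apply: sub; rewrite inE zp orbT.
Qed.

(** * Shrinking the territory *)

Definition component (S : {set V}) (r : V) : {set V} :=
  [set y in S | connect (restr e S) r y].

Lemma component_self (S : {set V}) r : r \in S -> r \in component S r.
Proof. by move=> rS; rewrite inE rS connect0. Qed.

Lemma component_closed (S : {set V}) r x y :
  x \in component S r -> y \in S -> e x y -> y \in component S r.
Proof.
rewrite !inE => /andP [xS rx] yS exy; rewrite yS /=.
by apply: connect_trans rx _; apply: connect1; rewrite /restr /= exy xS.
Qed.

Lemma component_conn (S : {set V}) r : conn (component S r).
Proof.
have W p u : u \in component S r -> path (restr e S) u p ->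
    connect (restr e (component S r)) u (last u p).
  elim: p u => [|y p IH] u uC /=; first by rewrite connect0.
  move=> /andP [/and3P [h uS yS] hp].
  have yC := component_closed uC yS h.
  apply: connect_trans (IH y yC hp); apply: connect1.
  by rewrite /restr /= h uC yC.
have H x : x \in component S r -> connect (restr e (component S r)) r x.
  rewrite inE => /andP [xS /connectP [p hp lp]].
  have rS : r \in S by case: p hp lp => [_ /= <-|y p /= /andP [/and3P [_ ->]]].
  by rewrite lp; apply: W hp; apply: component_self.
move=> x y xC yC; apply: connect_trans (H _ yC).
by rewrite (sym_connect_sym (@restr_sym _)) H.
Qed.

(** Either a cycle cut into two guarded segments, or a path carried by the first guard alone. *)
Definition shape (A B : seq V) : Prop :=
  (cycle e (A ++ B) /\ uniq (A ++ B)) \/ (B = [::] /\ sorted e A /\ uniq A).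

(* What the cops may assume about the territory left to the robber once the
   path [P] is guarded too. *)
Definition residue (R : {set V}) (P : seq V) (R' : {set V}) : Prop :=
  [/\ R' \subset R, {in P, forall z, z \notin R'}, conn R'
    & {in R', forall x y, y \notin R' -> e x y -> y \notin R \/ y \in P}].

(** The three guards are renamed so that [ra] and [rb] suffice for the new territory while [rc]
    becomes a free cop. *)
Definition reguard (R' K' : {set V}) (r1 r2 r3 : V -> V) : Prop :=
  exists ra rb rc A B,
  [/\ forall x, perm_eq [:: ra x; rb x; rc x] [:: r1 x; r2 x; r3 x],
      guard R' K' ra A, guard R' K' rb B,
      {in R', forall x y, y \notin R' -> e x y -> y \in A ++ B}
    & shape A B /\ {subset A ++ B <= K'}].

Definition winning (R : {set V}) : Prop :=
  forall K r1 A r2 B, arena R K r1 A r2 B -> shape A B -> {subset A ++ B <= K} ->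
  forall f1 f2, f1 \in K -> f2 \in K ->
  {in R, forall r, rwin [:: r1 r; r2 r; f1; f2] r}.

(** This is the induction step shared by all cases. Both free cops reach the shadow [rho r], and the
    territory shrinks to the robber's component off the path, losing [w]. The dismissed guard and
    one of the two cops on [rho r] form the next free pair, up to a permutation of the cops. *)
Lemma advance (R K : {set V}) r1 A r2 B s q idx f1 f2 :
  arena R K r1 A r2 B -> (forall R' : {set V}, #|R'| < #|R| -> winning R') ->
  f1 \in K -> f2 \in K -> s \in K -> shadow R s q idx ->
  (exists2 w, w \in q & w \in R) ->
  let rho x := nth s (s :: q) (idx x) in
  let K' := K :|: [set z in q] in
  (forall R', residue R (s :: q) R' -> guard R' K' rho (s :: q) ->
     reguard R' K' r1 r2 rho) ->
  {in R, forall r, rwin [:: r1 r; r2 r; f1; f2] r}.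
Proof.
move=> ar IH f1K f2K sK sh [w wq wR] rho K' next.
apply: (gather ar sK f1K f2K); apply: (march ar sK sh) => r rR ne.
have [_ cK KR [g1 g2] cover] := ar.
have [pq idx_le hom fixP colfix] := sh.
set R' := component (R :\: [set z in s :: q]) r.
have rP : r \notin s :: q.
  rewrite inE negb_or; apply/andP; split.
    by apply/eqP=> E; move: (KR s sK); rewrite -E rR.
  by apply/negP=> rq; apply: ne; case: (colfix r rR) => _ /(_ rq).
have rR' : r \in R' by apply: component_self; rewrite in_setD rR inE rP.
have sub x : x \in R' -> x \in R /\ x \notin s :: q.
  by rewrite inE => /andP [] /setDP [xR]; rewrite inE => xP _.
have res : residue R (s :: q) R'.
  split.
  - by apply/subsetP=> x /sub [].
  - by move=> z zP; apply/negP=> /sub []; rewrite zP.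
  - exact: component_conn.
  move=> x xR' y yR' exy; have [yR|] := boolP (y \in R); [right | by left].
  apply: contraNT yR' => yP; apply: component_closed xR' _ exy.
  by rewrite in_setD yR inE yP.
have sPK : {subset s :: q <= K'}.
  by move=> z; rewrite !inE => /orP [/eqP->|->]; rewrite ?sK ?orbT.
have g3 : guard R' K' rho (s :: q).
  split.
  - by move=> x y /sub [xR _] /sub [yR _] /(hom _ _ xR yR) [].
  - by move=> x /sub [xR _] y yP; apply: fixP.
  - by move=> x _; apply/sPK/mem_nth; rewrite /= ltnS.
  - by move=> x /sub [xR _]; case: (colfix x xR).
have [ra [rb [rc [A' [B' [pe ga gb cov [sha sAB]]]]]]] := next R' res g3.
have lt : #|R'| < #|R|.
  apply: proper_card; apply/properP; split; first by case: res.
  by exists w => //; apply/negP=> /sub []; rewrite inE wq orbT.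
have ar' : arena R' K' ra A' rb B'.
  split; [exact: component_conn | exact: conn_extend cK sK pq | | by split | exact: cov].
  move=> x xK'; apply/negP=> /sub [xR]; move: xK'; rewrite in_setU !inE.
  by case/orP=> [/KR|->]; rewrite ?xR ?orbT.
have sKK : K \subset K' by apply: subsetUl.
have inK rh : rh = r1 r \/ rh = r2 r \/ rh = rho r -> rh \in K'.
  case=> [->|[->|->]].
  - by apply: (subsetP sKK); case: g1 => _ _ h _; apply: h.
  - by apply: (subsetP sKK); case: g2 => _ _ h _; apply: h.
  - by apply/sPK/mem_nth; rewrite /= ltnS.
have rcK : rc r \in K'.
  apply: inK; have : rc r \in [:: ra r; rb r; rc r] by rewrite !inE eqxx !orbT.
  by rewrite (perm_mem (pe r)) !inE => /or3P [] /eqP ->; auto.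
have rhoK : rho r \in K' by apply: inK; auto.
apply: rwin_perm (IH R' lt K' ra A' rb B' ar' sha sAB (rc r) (rho r) rcK rhoK r rR').
have -> : [:: ra r; rb r; rc r; rho r] = [:: ra r; rb r; rc r] ++ [:: rho r] by [].
have -> : [:: r1 r; r2 r; rho r; rho r] = [:: r1 r; r2 r; rho r] ++ [:: rho r] by [].
by rewrite perm_cat2r.
Qed.

(** * Folding onto edges and geodesics *)

(** A bipartite graph folds onto any of its edges by colour; the Boolean index is 0 on the colour of
    [s]. *)
Lemma edge_shadow (R : {set V}) s w : e s w ->
  shadow R s [:: w] (fun x => col x != col s).
Proof.
move=> esw.
have rhoE x : nth s [:: s; w] (col x != col s) = if col x == col s then s else w.
  by case: eqP.
have cw : (col w == col s) = false by apply/negbTE; rewrite eq_sym colP.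
split.
- by rewrite /= esw.
- by move=> x; case: (_ != _).
- move=> x y _ _ /colP; rewrite !rhoE.
  by case: (col x); case: (col y); case: (col s); rewrite //= 1?esym esw.
- move=> x _ y; rewrite !inE rhoE => /orP [] /eqP -> /colP.
    by move/negbTE->; rewrite esym.
  by move: cw; case: (col x); case: (col w); case: (col s).
- move=> x _; rewrite rhoE; split.
    case: eqP => [->//|]; move: cw.
    by case: (col x); case: (col w); case: (col s).
  by rewrite inE => /eqP ->; rewrite cw.
Qed.

Lemma dist_exists (h : rel V) s : exists d : V -> nat, forall x, connect h s x ->
  (exists p, [/\ path h s p, last s p = x & size p = d x]) /\
  (forall p, path h s p -> last s p = x -> d x <= size p).
Proof.
suff ex x : exists n, connect h s x ->
    (exists p, [/\ path h s p, last s p = x & size p = n]) /\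
    (forall p, path h s p -> last s p = x -> n <= size p).
  by have [d hd] := fin_all_exists ex; exists d.
have [c|nc] := boolP (connect h s x); last by exists 0.
pose P n := [exists p : n.-tuple V, path h s p && (last s p == x)].
have exP : exists n, P n.
  case/connectP: c => p hp lp; exists (size p); apply/existsP.
  by exists (in_tuple p); rewrite hp lp eqxx.
have [n /existsP [p /andP [hp /eqP lp]] nmin] := ex_minnP exP.
exists n => _; split; first by exists p; rewrite size_tuple.
move=> p' hp' lp'; apply: nmin; apply/existsP.
by exists (in_tuple p'); rewrite hp' lp' eqxx.
Qed.

Lemma path_col (h : rel V) s p : subrel h e -> path h s p ->
  col (last s p) = col s (+) odd (size p).
Proof.
move=> sub; elim: p s => [|y p IH] s /=; first by rewrite addbF.
move=> /andP [/sub /colP hsy /IH ->].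
by move: hsy; case: (col s); case: (col y); case: (odd _).
Qed.

(* Distances beyond the end of a geodesic of length [n] bounce between
   positions [n] and [n - 1], which respects the bipartition. *)
Definition bounce n d := if d <= n then d else n - odd (d - n).

Lemma bounce_le n d : bounce n d <= n.
Proof. by rewrite /bounce; case: ifP => // _; apply: leq_subr. Qed.

Lemma bounce_step n d : 0 < n -> bounce n d.+1 = (bounce n d).+1 \/
  bounce n d = (bounce n d.+1).+1.
Proof.
move=> n0; rewrite /bounce; case: (ltngtP d n) => [lt|lt|->].
- by left.
- by rewrite (subSn (ltnW lt)) /=; case: (odd (d - n)); [left | right]; lia.
- by right; rewrite subSnn; lia.
Qed.

Lemma odd_bounce n d : 0 < n -> odd (bounce n d) = odd d.
Proof.
by move=> n0; rewrite /bounce; case: leqP => // lt; lia.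
Qed.

(** The position of the shadow is the distance from [s], bounced back at the end of a shortest path
    from [s] to [t] through [R]. *)
Lemma geodesic_shadow (R : {set V}) s t xs xt :
  conn R -> s \notin R -> t \notin R -> s != t ->
  xs \in R -> e s xs -> xt \in R -> e xt t ->
  exists X idx, [/\ shadow R s (rcons X t) idx, X != [::], {subset X <= R}
    & uniq X].
Proof.
move=> cR sR tR st xsR esxs xtR extt.
(* Edges without an end in [R] are dropped: a direct edge from [s] to [t] would leave no interior
   vertex on the geodesic. *)
pose h : rel V := fun x y => restr e (s |: (t |: R)) x y && ((x \in R) || (y \in R)).
have sub : subrel h e by move=> x y /andP [] /and3P [].
have hsym : symmetric h.
  by move=> x y; rewrite /h restr_sym orbC.
have RS x : x \in R -> x \in s |: (t |: R) by move=> xR; rewrite !inE xR !orbT.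
have tS : t \in s |: (t |: R) by rewrite !inE eqxx !orbT.
have sS : s \in s |: (t |: R) by rewrite !inE eqxx.
have hR x y : x \in R -> y \in s |: (t |: R) -> e x y -> h x y.
  by move=> xR yS exy; rewrite /h /restr /= exy xR yS RS.
have cxs : connect h s xs.
  by apply: connect1; rewrite hsym; apply: hR => //; rewrite esym.
have cRh x : x \in R -> connect h s x.
  move=> xR; apply: connect_trans cxs _; apply: connect_sub (cR _ _ xsR xR).
  by move=> u v /and3P [euv uR vR]; apply: connect1; apply: hR => //; apply: RS.
have ct : connect h s t.
  by apply: connect_trans (cRh _ xtR) _; apply: connect1; apply: hR.
have cS x : x \in s |: (t |: R) -> connect h s x.
  by rewrite !inE => /or3P [/eqP->|/eqP->|/cRh].
have [d hd] := dist_exists h s.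
have d_le x y : connect h s x -> h x y -> d y <= (d x).+1.
  move=> cx hxy; have [[p [hp lp <-]] _] := hd x cx.
  have [_ m] := hd y (connect_trans cx (@connect1 _ h _ _ hxy)).
  rewrite -(size_rcons p y); apply: m; last by rewrite last_rcons.
  by rewrite rcons_path hp lp.
have d_col x : connect h s x -> col x = col s (+) odd (d x).
  by move=> cx; have [[p [hp <- <-]] _] := hd x cx; apply: path_col hp.
have [[p [hp lp sp]] tmin] := hd t ct.
have d_nth i : i <= size p -> d (nth s (s :: p) i) = i.
  move=> le.
  have l1 : last s (take i p) = nth s (s :: p) i.
    rewrite (last_nth s) size_takel //; case: i le => // i le.
    by rewrite /= nth_take.
  have : path h s (take i p ++ drop i p) by rewrite cat_take_drop.
  rewrite cat_path l1 => /andP [h1 h2].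
  have l2 : last (nth s (s :: p) i) (drop i p) = t.
    by rewrite -l1 -last_cat cat_take_drop.
  have ci : connect h s (nth s (s :: p) i) by apply/connectP; exists (take i p).
  have [[p' [hp' lp' sp']] m] := hd _ ci.
  apply/eqP; rewrite eqn_leq; apply/andP; split.
    by have := m _ h1 l1; rewrite size_takel.
  have := tmin (p' ++ drop i p); rewrite cat_path lp' hp' h2 last_cat lp' l2.
  by move=> /(_ isT erefl); rewrite size_cat size_drop -sp sp'; move: le; clear; lia.
have mem_d x : x \in s :: p -> x = nth s (s :: p) (d x) /\ d x <= size p.
  by move=> /(nthP s) [i lti <-]; rewrite d_nth.
have n0 : 0 < size p by case: (p) lp => //= E; rewrite E eqxx in st.
pose idx x := bounce (size p) (d x).
have uniqp : uniq (s :: p).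
  apply: (@map_uniq _ _ d); suff -> : map d (s :: p) = iota 0 (size p).+1 by apply: iota_uniq.
  apply: (@eq_from_nth _ 0); first by rewrite size_map size_iota.
  move=> i; rewrite size_map => lti.
  by rewrite (nth_map s) // d_nth // nth_iota.
have idx_fix x : x \in s :: p -> nth s (s :: p) (idx x) = x.
  by move/mem_d=> [E le]; rewrite /idx /bounce le -E.
(* Distances of neighbours differ by at most one, and by parity of the colours they are not
   equal. *)
have d_adj x y : x \in R -> y \in s |: (t |: R) -> e x y ->
    d y = (d x).+1 \/ d x = (d y).+1.
  move=> xR yS exy; have hxy := hR _ _ xR yS exy.
  have := d_le _ _ (cS _ (RS _ xR)) hxy.
  have := d_le y x (cS _ yS); rewrite hsym => /(_ hxy).
  have := colP exy; rewrite (d_col x) ?cS ?RS // (d_col y) ?cS //.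
  case: (ltngtP (d x) (d y)) => [lt|lt|->]; last by rewrite eqxx.
    by move=> _ h1 h2; left; move: lt h1 h2; clear; lia.
  by move=> _ h1 h2; right; move: lt h1 h2; clear; lia.
have idx_adj x y : x \in R -> y \in s |: (t |: R) -> e x y ->
    idx y = (idx x).+1 \/ idx x = (idx y).+1.
  move=> xR yS exy; rewrite /idx.
  case: (d_adj _ _ xR yS exy) => ->.
    by case: (bounce_step (d x) n0); auto.
  by case: (bounce_step (d y) n0); auto.
have idx_e x y : x \in R -> y \in s |: (t |: R) -> e x y ->
    e (nth s (s :: p) (idx x)) (nth s (s :: p) (idx y)).
  have pe : path e s p by apply: sub_path hp.
  have le z : idx z <= size p by apply: bounce_le.
  move=> xR yS exy; case: (idx_adj _ _ xR yS exy) => E; rewrite E.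
    by apply: (pathP s pe); rewrite -E.
  by rewrite esym; apply: (pathP s pe); rewrite -E.
have pS z : z \in s :: p -> z \in s |: (t |: R).
  rewrite inE => /orP [/eqP-> //|zp]; move: hp.
  case/splitPr: zp => p1 p2; rewrite cat_path /=.
  by case/and3P=> _ /andP [] /and3P [].
have [X pX] : exists X, p = rcons X t.
  by case/lastP: (p) lp n0 => // X y; rewrite last_rcons => ->; exists X.
exists X, idx; rewrite -pX.
have XR z : z \in X -> z \in R.
  move=> zX; have zp : z \in s :: p by rewrite pX inE mem_rcons inE zX !orbT.
  have := pS z zp; rewrite !inE => /or3P [/eqP E|/eqP E|//]; exfalso.
    by move: uniqp; rewrite /= pX mem_rcons inE -E zX orbT.
  by move: uniqp; rewrite /= pX rcons_uniq -E zX andbF.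
split=> //.
- split.
  + exact: sub_path hp.
  + by move=> x; apply: bounce_le.
  + move=> x y xR yR exy; split; first by apply: idx_e => //; apply: RS.
    by case: (idx_adj _ _ xR (RS _ yR) exy) => -> //; apply: leqW.
  + move=> x xR y yp exy; rewrite -(idx_fix y yp).
    by apply: idx_e => //; apply: pS.
  + move=> x xR; split; last by move=> xp; apply: idx_fix; rewrite inE xp orbT.
    have le : idx x <= size p by apply: bounce_le.
    have cn : connect h s (nth s (s :: p) (idx x)) by apply/cS/pS/mem_nth.
    by rewrite (d_col _ cn) (d_col x (cS _ (RS _ xR))) d_nth // odd_bounce.
- apply/eqP=> X0; move: hp; rewrite pX X0 /= andbT /h => /andP [_].
  by rewrite (negbTE sR) (negbTE tR).
- by move: uniqp; rewrite pX /= rcons_uniq => /and3P [].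
Qed.

(** The cases count the elements satisfying [p]: none, one, or at least two. In the last, [s] and
    [t] are the first and the last of them, and [A1] may contain more. *)
Lemma split_first_last (T : eqType) (p : pred T) (A : seq T) :
  [\/ {in A, forall y, ~~ p y},
      exists A0 s A1, [/\ A = A0 ++ s :: A1, p s,
        {in A0, forall y, ~~ p y} & {in A1, forall y, ~~ p y}]
    | exists A0 s A1 t A2, [/\ A = A0 ++ s :: A1 ++ t :: A2, p s, p t,
        {in A0, forall y, ~~ p y} & {in A2, forall y, ~~ p y}]].
Proof.
elim: A => [|a A IH]; first by constructor 1.
have [pa|npa] := boolP (p a).
  case: IH => [h|[A0 [s [A1 [-> ps h0 h1]]]]|[A0 [s [A1 [t [A2 [-> ps pt h0 h2]]]]]]].
  - by constructor 2; exists [::], a, A.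
  - by constructor 3; exists [::], a, A0, s, A1.
  - constructor 3; exists [::], a, (A0 ++ s :: A1), t, A2; split=> //.
    by rewrite /= -catA.
have cons0 A0 : {in A0, forall y, ~~ p y} -> {in a :: A0, forall y, ~~ p y}.
  by move=> h y; rewrite inE => /orP [/eqP->|/h].
case: IH => [h|[A0 [s [A1 [-> ps h0 h1]]]]|[A0 [s [A1 [t [A2 [-> ps pt h0 h2]]]]]]].
- by constructor 1; apply: cons0.
- by constructor 2; exists (a :: A0), s, A1; split=> //; apply: cons0.
- by constructor 3; exists (a :: A0), s, A1, t, A2; split=> //; apply: cons0.
Qed.

Lemma perm3 (T : eqType) (a b c : T) :
  [/\ perm_eq [:: c; a; b] [:: a; b; c], perm_eq [:: a; c; b] [:: a; b; c]
    & perm_eq [:: c; b; a] [:: a; b; c]].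
Proof. by split; apply/permP=> p /=; lia. Qed.

Lemma cycle_split s Y t Z :
  cycle e (s :: Y ++ t :: Z) = path e s (rcons Y t) && path e t (rcons Z s).
Proof. by rewrite /= rcons_cat /= cat_path rcons_path /= andbA. Qed.

Lemma rev_path_sym s Y t : path e s (rcons Y t) -> path e t (rcons (rev Y) s).
Proof.
move=> h; have := rev_path e s (rcons Y t).
rewrite last_rcons belast_rcons rev_cons => ->.
by rewrite (@eq_path _ _ e) // => x y /=; rewrite esym.
Qed.

Definition contact (R : {set V}) : pred V := fun y => [exists x in R, e x y].

Lemma contactP (R : {set V}) y :
  reflect (exists2 x, x \in R & e x y) (contact R y).
Proof. exact: exists_inP. Qed.

(** * Cutting the territory by an edge or a chord *)

Section Claim.

Hypothesis eplanar : planar e.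

Variables (R K : {set V}) (r1 r2 : V -> V) (A B : seq V) (f1 f2 : V).
Hypothesis IH : forall R' : {set V}, #|R'| < #|R| -> winning R'.
Hypothesis ar : arena R K r1 A r2 B.
Hypothesis sAB : {subset A ++ B <= K}.
Hypotheses (f1K : f1 \in K) (f2K : f2 \in K).

Let KR : {in K, forall x, x \notin R}.
Proof. by case: ar. Qed.

Let cover x y : x \in R -> y \notin R -> e x y -> y \in A ++ B.
Proof. by case: ar => _ _ _ _ h xR; apply: h. Qed.

Lemma win_one_contact s : s \in K -> contact R s ->
  (forall x y, x \in R -> y \notin R -> e x y -> y = s) ->
  {in R, forall r, rwin [:: r1 r; r2 r; f1; f2] r}.
Proof.
move=> sK /contactP [w wR ews] only.
have esw : e s w by rewrite esym.
apply: (advance ar IH f1K f2K sK (edge_shadow R esw)).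
  by exists w; rewrite ?inE.
move=> R' [sR' _ _ bd] g3.
have [_ _ _ [g1 g2] _] := ar.
exists (fun x => nth s [:: s; w] (col x != col s)), r1, r2, [:: s; w], [::].
split=> //.
- by move=> x; case: (perm3 (r1 x) (r2 x) (nth s [:: s; w] (col x != col s))).
- by apply: (guard_mono g1) => //; apply: subsetUl.
- move=> x xR' y yR' exy; have [yR|//] := bd x xR' y yR' exy.
  by rewrite (only x y) ?inE ?eqxx // (subsetP sR').
split.
  right; split=> //; split; first by rewrite /= esw.
  by rewrite /= inE !andbT; apply/eqP=> E; rewrite E eirr in esw.
by move=> z; rewrite /= !inE => /orP [] /eqP->; rewrite ?sK ?eqxx ?orbT.
Qed.

(** A geodesic through the territory contains both exits, so its guard alone holds the new boundary,
    a path. *)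
Lemma win_two_contacts s t : s \in K -> t \in K -> s != t ->
  contact R s -> contact R t ->
  (forall x y, x \in R -> y \notin R -> e x y -> y = s \/ y = t) ->
  {in R, forall r, rwin [:: r1 r; r2 r; f1; f2] r}.
Proof.
move=> sK tK st /contactP [xs xsR exs] /contactP [xt xtR ext] only.
have [cR _ _ [g1 g2] _] := ar.
have esx : e s xs by rewrite esym.
have [X [idx [sh X0 XR uX]]] :=
  geodesic_shadow cR (KR sK) (KR tK) st xsR esx xtR ext.
apply: (advance ar IH f1K f2K sK sh).
  by case: (X) X0 XR => // w X' _ XR; exists w; rewrite ?XR ?inE ?eqxx.
move=> R' [sR' _ _ bd] g3.
exists (fun x => nth s (s :: rcons X t) (idx x)), r1, r2, (s :: rcons X t), [::].
split=> //.
- by move=> x; case: (perm3 (r1 x) (r2 x) (nth s (s :: rcons X t) (idx x))).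
- by apply: (guard_mono g1) => //; apply: subsetUl.
- move=> x xR' y yR' exy; rewrite cats0.
  have [yR|//] := bd x xR' y yR' exy.
  by have [->|->] := only x y (subsetP sR' _ xR') yR exy;
    rewrite !inE ?mem_rcons ?inE ?eqxx ?orbT.
split.
  right; split=> //; split; first by case: sh.
  rewrite /= rcons_uniq uX andbT mem_rcons inE negb_or st /=.
  by apply/andP; split; apply/negP=> /XR; apply/negP; apply: KR.
by move=> z; rewrite cats0 !inE => /orP [/eqP->|->]; rewrite ?sK ?orbT.
Qed.

Section Chord.

Variables (A0 A1 A2 : seq V) (s t : V).
Hypothesis AE : A = A0 ++ s :: A1 ++ t :: A2.
Hypotheses (cs : contact R s) (ct : contact R t).
Hypothesis n0 : {in A0, forall y, ~~ contact R y}.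
Hypothesis n2 : {in A2, forall y, ~~ contact R y}.

Let sK : s \in K.
Proof. by apply: sAB; rewrite AE !mem_cat inE eqxx !orbT. Qed.

Let tK : t \in K.
Proof. by apply: sAB; rewrite AE !(mem_cat, inE) eqxx !orbT. Qed.

(* The territory lies on the side of the chord [s :: rcons X t] bounded by the
   segment of [A] between [s] and [t]. *)
Lemma reguard_segment X rho K' R' :
  residue R (s :: rcons X t) R' ->
  guard R' K' rho (s :: rcons X t) -> K \subset K' -> {subset X <= K'} ->
  {subset X <= R} -> path e s (rcons A1 t) -> path e s (rcons X t) ->
  uniq (s :: rcons A1 t) -> uniq X ->
  {in R', forall x, {in A ++ B, forall y, e x y -> y \in s :: rcons A1 t}} ->
  reguard R' K' r1 r2 rho.
Proof.
move=> [sR' _ _ bd] g3 KK' XK' XR pA pX uA uX seg.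
have [_ _ _ [g1 g2] _] := ar.
have sA : {subset s :: rcons A1 t <= A}.
  move=> z; rewrite AE inE mem_rcons inE !mem_cat inE mem_cat inE.
  by case/or3P=> ->; rewrite ?orbT.
exists r1, rho, r2, (s :: rcons A1 t), (rev X); split=> //.
- by move=> x; case: (perm3 (r1 x) (r2 x) (rho x)).
- by apply: (guard_mono g1) => // x y _ yA _; apply: sA.
- apply: (guard_mono g3) => // x y _; rewrite mem_rev => yX _.
  by rewrite inE mem_rcons inE yX !orbT.
- move=> x xR' y yR' exy; rewrite mem_cat mem_rev.
  have [yR|] := bd x xR' y yR' exy.
    by rewrite (seg x) //; apply: cover exy => //; apply: (subsetP sR').
  rewrite !inE !mem_rcons !inE => /or3P [] -> //; rewrite ?orbT //.
split.
  left; split.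
    by rewrite cat_cons cat_rcons cycle_split pA rev_path_sym.
  rewrite cat_uniq uA rev_uniq uX andbT /=; apply/hasPn=> z.
  rewrite mem_rev => /XR zR; apply/negP=> /sA zA.
  have : z \in K by apply: sAB; rewrite mem_cat zA.
  by move/KR; rewrite zR.
move=> z; rewrite mem_cat mem_rev => /orP [/sA zA|/XK' //].
by apply: (subsetP KK'); apply: sAB; rewrite mem_cat zA.
Qed.

(** The chord and the segment of [A] between the extreme contacts [s] and [t] form a cycle; the
    parts of [A] beyond them do not touch the territory. *)
Lemma win_path_chord : B = [::] -> sorted e A -> uniq A ->
  {in R, forall r, rwin [:: r1 r; r2 r; f1; f2] r}.
Proof.
move=> B0 sortA uA.
have [cR _ _ [g1 g2] _] := ar.
have [xs xsR exs] := contactP _ _ cs; have [xt xtR ext] := contactP _ _ ct.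
have esx : e s xs by rewrite esym.
have st : s != t.
  move: uA; rewrite AE cat_uniq => /and3P [_ _ /andP []].
  by rewrite mem_cat inE negb_or => /andP [_]; rewrite negb_or => /andP [].
have [X [idx [sh X0 XR uX]]] :=
  geodesic_shadow cR (KR sK) (KR tK) st xsR esx xtR ext.
apply: (advance ar IH f1K f2K sK sh).
  by case: (X) X0 XR => // w X' _ XR; exists w; rewrite ?XR ?inE ?eqxx.
move=> R' res g3; have [sR' _ _ _] := res.
apply: (reguard_segment res g3 _ _ XR) => //.
- exact: subsetUl.
- by move=> z zX; rewrite !inE mem_rcons inE zX !orbT.
- have : path e s (A1 ++ t :: A2).
    by move: sortA; rewrite AE; case: (A0) => //= a l; rewrite cat_path /= => /and3P [].
  by rewrite -cat_rcons cat_path => /andP [].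
- by case: sh.
- move: uA; rewrite AE cat_uniq => /and3P [_ _].
  by rewrite -cat_rcons -cat_cons cat_uniq => /and3P [].
move=> x xR' y yA exy.
have cy : contact R y by apply/contactP; exists x => //; apply: (subsetP sR').
move: yA; rewrite B0 cats0 AE !(mem_cat, inE) mem_rcons inE.
case/orP=> [/n0|/orP [->//|/orP [->|/orP [->|/n2]]]]; rewrite ?cy ?orbT //.
Qed.

(* Planarity: the part of the robber's territory left by the chord cannot touch
   the chord and both sides of the cycle. *)
Lemma win_cycle_chord : cycle e (A ++ B) -> uniq (A ++ B) ->
  {in R, forall r, rwin [:: r1 r; r2 r; f1; f2] r}.
Proof.
move=> cyc uAB.
have [cR _ _ [g1 g2] _] := ar.
have [xs xsR exs] := contactP _ _ cs; have [xt xtR ext] := contactP _ _ ct.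
have esx : e s xs by rewrite esym.
(* The other side of the cycle, leading from [t] through [B] back towards [s]. *)
pose D := A2 ++ B ++ A0.
have rotE : rot (size A0) (A ++ B) = s :: A1 ++ t :: D.
  by rewrite AE -!catA rot_size_cat /D /= -?catA /= -?catA.
have cycC : cycle e (s :: A1 ++ t :: D) by rewrite -rotE rot_cycle.
have uC : uniq (s :: A1 ++ t :: D) by rewrite -rotE rot_uniq.
have memC z : z \in s :: A1 ++ t :: D -> z \in A ++ B.
  by rewrite -rotE mem_rot.
have /andP [pA pD] : path e s (rcons A1 t) && path e t (rcons D s).
  by rewrite -cycle_split.
have /and5P [sA1 st sD uA1 /and4P [tA1 A1D tD uD]] :
  [&& s \notin A1, s != t, s \notin D, uniq A1,
      t \notin A1, ~~ has (mem A1) D, t \notin D & uniq D].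
  by move: uC; rewrite /= mem_cat inE cat_uniq /= !negb_or -!andbA.
have [X [idx [sh X0 XR uX]]] :=
  geodesic_shadow cR (KR sK) (KR tK) st xsR esx xtR ext.
apply: (advance ar IH f1K f2K sK sh).
  by case: (X) X0 XR => // w X' _ XR; exists w; rewrite ?XR ?inE ?eqxx.
pose rho x := nth s (s :: rcons X t) (idx x).
pose K' := K :|: [set z in rcons X t].
move=> R' res; rewrite -/rho -/K' => g3; have [sR' PR' cR' bd] := res.
have pX : path e s (rcons X t) by case: sh.
have KK' : K \subset K' by apply: subsetUl.
have XK' : {subset X <= K'}.
  by move=> z zX; rewrite /K' !inE mem_rcons inE zX !orbT.
have contactR x y : x \in R' -> e x y -> contact R y.
  by move=> xR' exy; apply/contactP; exists x => //; apply: (subsetP sR').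
have sX : s \notin X by apply/negP=> /XR; apply/negP; apply: KR.
have tX : t \notin X by apply/negP=> /XR; apply/negP; apply: KR.
have XC z : z \in X -> z \notin s :: A1 ++ t :: D.
  move=> /XR zR; apply/negP=> /memC /sAB /KR; by rewrite zR.
(* The interiors of three disjoint paths from [s] to [t]: the two sides of the cycle and the
   chord. *)
pose Y (k : 'I_3) := nth [::] [:: A1; rev D; X] k.
have pY k : path e s (rcons (Y k) t).
  by case: k => [[|[|[|//]]]] lt //; apply: rev_path_sym.
have YC k z : z \in Y k -> (z \in s :: A1 ++ t :: D) || (z \in X).
  case: k => [[|[|[|//]]]] lt; rewrite /Y /= ?mem_rev => zY.
  - by rewrite inE mem_cat zY orbT.
  - by rewrite inE mem_cat inE zY !orbT.
  - by rewrite zY orbT.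
have [k nk] : exists k, forall x y, x \in R' -> y \in Y k -> ~~ e x y.
  apply: NNPP => nex.
  apply: (@planar_theta V e s t Y R' esym eplanar pY st) => //.
  - move=> k; split.
    + by case: k => [[|[|[|//]]]] lt; rewrite /Y /= ?mem_rev.
    + by case: k => [[|[|[|//]]]] lt; rewrite /Y /= ?mem_rev.
    + move=> z /YC /orP [/memC /sAB /KR zR|zX].
        by apply: contra zR; apply: (subsetP sR').
      by apply: PR'; rewrite inE mem_rcons inE zX !orbT.
  - move: A1D => /hasPn A1D.
    have A1X z : z \in A1 -> z \notin X.
      by move=> zA; apply/negP=> /XC; rewrite inE mem_cat zA orbT.
    have DX z : z \in D -> z \notin X.
      by move=> zD; apply/negP=> /XC; rewrite inE mem_cat inE zD !orbT.
    case=> [[|[|[|//]]]] lt [[|[|[|//]]]] lt' //= _ z; rewrite /Y /= ?mem_rev.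
    + by move=> zA; apply/negP=> /A1D /=; rewrite zA.
    + exact: A1D.
    + exact: DX.
    + by move=> zX; apply/negP=> /A1X; rewrite zX.
    + by move=> zX; apply/negP=> /DX; rewrite zX.
  - by apply: PR'; rewrite inE eqxx.
  - by apply: PR'; rewrite inE mem_rcons inE eqxx !orbT.
  move=> k; apply: NNPP => nt; apply: nex; exists k => x y xR' yY.
  by apply/negP=> exy; apply: nt; exists x, y.
have memD z : z \in A ++ B -> z \in s :: A1 ++ t :: D by rewrite -rotE mem_rot.
have coverR' x y : x \in R' -> y \notin R' -> e x y ->
    y \in A ++ B \/ y \in s :: rcons X t.
  move=> xR' yR' exy; have [yR|] := bd x xR' y yR' exy; [left | by right].
  by apply: cover exy => //; apply: (subsetP sR').
case: k nk => [[|[|[|//]]]] lt; rewrite /Y /= => nk.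
(* [A1] is untouched: the chord replaces it inside [A], its guard takes over, and [r1] is freed.
   This works because [A0] and [A2] have no contacts. *)
- exists rho, r2, r1, (A0 ++ s :: X ++ t :: A2), B; split=> //.
  + by move=> x; case: (perm3 (r1 x) (r2 x) (rho x)).
  + apply: (guard_mono g3) => // x y xR' yA exy; move: yA.
    have cy := contactR x y xR' exy.
    rewrite !(mem_cat, inE) mem_rcons inE.
    by case/orP=> [/n0|/orP [->//|/orP [->|/orP [->|/n2]]]]; rewrite ?cy ?orbT.
  + by apply: (guard_mono g2).
  + move=> x xR' y yR' exy; have cy := contactR x y xR' exy.
    have [yAB|yP] := coverR' x y xR' yR' exy.
      have yA1 : y \notin A1 by apply/negP=> /(nk x y xR'); rewrite exy.
      move: yAB; rewrite AE !(mem_cat, inE) (negbTE yA1).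
      by case: (y \in A0); case: (y == s); case: (y == t); case: (y \in A2);
        case: (y \in B); rewrite ?orbT.
    move: yP; rewrite !(mem_cat, inE) mem_rcons inE.
    by case/or3P=> ->; rewrite ?orbT.
  split.
    have rotX : rot (size A0) ((A0 ++ s :: X ++ t :: A2) ++ B) = s :: X ++ t :: D.
      by rewrite -!catA rot_size_cat /D /= -?catA /= -?catA.
    have cycX : cycle e (s :: X ++ t :: D) by rewrite cycle_split pX.
    left; split; first by move: cycX; rewrite -rotX rot_cycle.
    suff : uniq (s :: X ++ t :: D) by rewrite -rotX rot_uniq.
    rewrite /= mem_cat inE cat_uniq /= !negb_or.
    rewrite sX st sD uX tX tD uD !andbT /=; apply/hasPn=> z zD; apply/negP=> /XC.
    by rewrite inE mem_cat inE zD !orbT.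
  move=> z zAB; have : z \in X \/ z \in A ++ B.
    move: zAB; rewrite AE !(mem_cat, inE); case: (z \in X); first by left.
    move=> h; right; move: h; by case: (z \in A0); case: (z == s); case: (z == t);
      case: (z \in A2); case: (z \in B); rewrite ?orbT.
  by case=> [/XK'|/sAB /(subsetP KK')].
(* [D] is untouched: the chord and the segment [A1] bound the territory, and [r2] is freed. *)
- apply: (reguard_segment res g3 KK' XK' XR) => //.
    by rewrite /= mem_rcons inE negb_or st sA1 rcons_uniq tA1.
  move=> x xR' y /memD yC exy; move: yC.
  have yD : y \notin D by apply/negP; rewrite -mem_rev => /(nk x y xR'); rewrite exy.
  rewrite !inE mem_cat inE mem_rcons inE (negbTE yD) orbF.
  by case: (y == s); case: (y == t); rewrite ?orbT ?orbF.
(* The chord is untouched: the old guards still hold the cycle, and [rho] is freed. *)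
exists r1, r2, rho, A, B; split=> //.
- by apply: (guard_mono g1).
- by apply: (guard_mono g2).
- move=> x xR' y yR' exy.
  have [//|] := coverR' x y xR' yR' exy.
  rewrite inE mem_rcons inE => /or3P [/eqP->|/eqP->|/(nk x y xR')].
  + by apply: memC; rewrite inE eqxx.
  + by apply: memC; rewrite inE mem_cat inE eqxx !orbT.
  + by rewrite exy.
split; first by left.
by move=> z /sAB; apply: (subsetP KK').
Qed.

End Chord.

End Claim.

Lemma arena_sym R K r1 A r2 B : arena R K r1 A r2 B -> arena R K r2 B r1 A.
Proof.
move=> [h1 h2 h3 [h4 h5] h6]; split=> // x xR y yR exy.
by rewrite mem_cat orbC -mem_cat; apply: (h6 x).
Qed.

Lemma contact_of (R : {set V}) x y : x \in R -> e x y -> contact R y.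
Proof. by move=> xR exy; apply/contactP; exists x. Qed.

Lemma exists_contact (R : {set V}) r f : (forall x y, connect e x y) ->
  r \in R -> f \notin R -> exists x y, [/\ x \in R, y \notin R & e x y].
Proof.
move=> econn; have /connectP [p] := econn r f.
elim: p r => [|y p IHp] r /=; first by move=> _ -> ->.
move=> /andP [ery hp] lp rR fR.
have [yR|yR] := boolP (y \in R); last by exists r, y.
exact: IHp hp lp yR fR.
Qed.

(** The contacts on [A] and [B] are counted: two on one side give a chord, one on each side or one
    in all are the special cases, and none contradicts connectedness. *)
Lemma winning_all (R : {set V}) : (forall x y, connect e x y) -> planar e ->
  winning R.
Proof.
move=> econn eplanar; have [n] := ubnP #|R|; elim: n R => // n IHn R ltn.
have {ltn}IH (R' : {set V}) : #|R'| < #|R| -> winning R'.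
  by move=> lt; apply: IHn; apply: leq_trans lt _; rewrite -ltnS.
move=> K r1 A r2 B ar shp sAB f1 f2 f1K f2K.
have [_ _ KR _ cover] := ar.
have sBA : {subset B ++ A <= K} by move=> z; rewrite mem_cat orbC -mem_cat => /sAB.
have long_B B0 s B1 t B2 : B = B0 ++ s :: B1 ++ t :: B2 ->
    contact R s -> contact R t ->
    {in B0, forall y, ~~ contact R y} -> {in B2, forall y, ~~ contact R y} ->
    {in R, forall r, rwin [:: r1 r; r2 r; f1; f2] r}.
  move=> BE ps pt h0 h2 r rR.
  apply: (@rwin_perm [:: r2 r; r1 r; f1; f2]).
    by rewrite -cat1s -(cat1s (r1 r)) perm_catCA.
  case: shp => [[cyc uAB]|[B0' _]]; last by move: BE; rewrite B0'; case: (B0).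
  apply: (win_cycle_chord eplanar IH (arena_sym ar) sBA f1K f2K BE) => //.
    by rewrite -(rot_size_cat A B) rot_cycle.
  by rewrite -(rot_size_cat A B) rot_uniq.
have one (C0 C1 : seq V) s : {in C0, forall y, ~~ contact R y} ->
    {in C1, forall y, ~~ contact R y} ->
    {in C0 ++ s :: C1, forall y, contact R y -> y = s}.
  move=> h0 h1 y; rewrite mem_cat inE => /or3P [/h0|/eqP ->|/h1] // /negP //.
case: (split_first_last (contact R) A) =>
  [hA|[A0 [a [A1 [AE pa ha0 ha1]]]]|[A0 [s [A1 [t [A2 [AE ps pt h0 h2]]]]]]].
- case: (split_first_last (contact R) B) =>
    [hB|[B0 [b [B1 [BE pb hb0 hb1]]]]|[B0 [s [B1 [t [B2 [BE ps pt h0 h2]]]]]]].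
  + move=> r rR; have [x [y [xR yR exy]]] := exists_contact econn rR (KR _ f1K).
    have := cover x xR y yR exy; have cy := contact_of xR exy.
    by rewrite mem_cat => /orP [/hA|/hB]; rewrite cy.
  + apply: (win_one_contact IH ar f1K f2K (s := b)) => //.
      by apply: sAB; rewrite BE !mem_cat inE eqxx !orbT.
    move=> x y xR yR exy; have := cover x xR y yR exy.
    have cy := contact_of xR exy; rewrite mem_cat => /orP [/hA|]; first by rewrite cy.
    by rewrite BE => /(one _ _ _ hb0 hb1); apply.
  + exact: long_B BE ps pt h0 h2.
- have aK : a \in K by apply: sAB; rewrite AE !mem_cat inE eqxx !orbT.
  case: (split_first_last (contact R) B) =>
    [hB|[B0 [b [B1 [BE pb hb0 hb1]]]]|[B0 [s [B1 [t [B2 [BE ps pt h0 h2]]]]]]].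
  + apply: (win_one_contact IH ar f1K f2K (s := a)) => //.
    move=> x y xR yR exy; have := cover x xR y yR exy.
    have cy := contact_of xR exy.
    rewrite mem_cat => /orP [|/hB]; last by rewrite cy.
    by rewrite AE => /(one _ _ _ ha0 ha1); apply.
  + apply: (win_two_contacts IH ar f1K f2K (s := a) (t := b)) => //.
    * by apply: sAB; rewrite BE !mem_cat inE eqxx !orbT.
    * case: shp => [[_ uAB]|[B0' _]]; last by move: BE; rewrite B0'; case: (B0).
      move: uAB; rewrite cat_uniq => /and3P [_ /hasPn dAB _].
      apply/eqP=> E; have := dAB b; rewrite BE mem_cat inE eqxx orbT => /(_ isT).
      by rewrite /= -E AE mem_cat inE eqxx orbT.
    * move=> x y xR yR exy; have := cover x xR y yR exy.
      have cy := contact_of xR exy; rewrite mem_cat AE BE => /orP [].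
        by move/(one _ _ _ ha0 ha1); left; auto.
      by move/(one _ _ _ hb0 hb1); right; auto.
  + exact: long_B BE ps pt h0 h2.
case: shp => [[cyc uAB]|[B0 [sortA uA]]].
  exact: (win_cycle_chord eplanar IH ar sAB f1K f2K AE).
exact: (win_path_chord IH ar sAB f1K f2K AE).
Qed.

(** All cops start at [x0] and move to the robber's shadow on an edge [x0 w], which becomes the
    first guarded path; if [x0] has no neighbour, it is the only vertex. *)
Lemma four_cops_win : connected_graph e -> planar e -> k_cops_win e 4.
Proof.
move=> [/card_gt0P [x0 _] econn] eplanar.
exists (nseq 4 x0); split=> // r.
have [w exw|now] := pickP (e x0); last first.
  have /connectP [p hp ->] := econn x0 r.
  case: p hp => [|y p] /=; last by rewrite now.
  by move=> _; apply: (@capture _ x0); rewrite ?inE ?eqxx // adjr_refl.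
pose rho x := nth x0 [:: x0; w] (col x != col x0).
have sh := edge_shadow setT exw.
apply: (@CopsWin _ _ _ _ (nseq 4 (rho r))).
  have a : adj x0 (rho r).
    by rewrite /rho; case: (_ != _); rewrite /= ?adjr_refl // /adjr exw orbT.
  by rewrite /= a.
have [rP|rP] := boolP (r \in [:: x0; w]).
  left; rewrite !inE /rho; move: rP; rewrite !inE => /orP [] /eqP ->.
    by rewrite eqxx /= eqxx.
  by rewrite [col w == _]eq_sym (colP exw) /= eqxx.
right; set R := component (~: [set x0; w]) r.
have rR : r \in R by apply: component_self; rewrite !inE; move: rP; rewrite !inE.
have sub x : x \in R -> x \notin [:: x0; w].
  by rewrite inE => /andP []; rewrite !inE.
have [_ _ hom fixP colfix] := sh.
have g : guard R [set x0; w] rho [:: x0; w].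
  split.
  - by move=> x y _ _ exy; case: (hom x y (in_setT _) (in_setT _) exy).
  - by move=> x _ y yP; apply: fixP.
  - by move=> x _; rewrite /rho; case: (_ != _); rewrite !inE eqxx ?orbT.
  - by move=> x _; case: (colfix x (in_setT _)).
have rhoK x : rho x \in [set x0; w].
  by rewrite /rho; case: (_ != _); rewrite !inE eqxx ?orbT.
(* Two of the four cops on [rho r] count as guards, the second with an empty list, and two as
   free. *)
apply: (@winning_all R econn eplanar [set x0; w] rho [:: x0; w] rho [::]) => //.
- split=> //.
  + exact: component_conn.
  + have E : [set x0; w] = [set x0] :|: [set z in [:: w]].
      by apply/setP=> z; rewrite !inE.
    rewrite E; apply: (@conn_extend _ x0); rewrite ?inE //= ?exw //.
    by move=> x y /set1P -> /set1P ->; apply: connect0.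
  + by move=> x xP; apply/negP=> /sub; rewrite !inE in xP *; rewrite xP.
  + by split=> //; case: g => h1 _ h3 h4; split.
  + move=> x xR y yR exy; rewrite cats0; apply: contraNT yR => yP.
    by apply: component_closed xR _ exy; rewrite !inE; move: yP; rewrite !inE.
- right; split=> //; split; first by rewrite /= exw.
  by rewrite /= inE andbT; apply/eqP=> E; move: exw; rewrite E eirr.
- by move=> z; rewrite cats0 !inE.
Qed.

End Game.

Lemma exists_cc (V : finType) (e : rel V) n : k_cops_win e n ->
  exists2 k, is_cc e k & k <= n.
Proof.
elim/ltn_ind: n => n IH win.
case: (classic (exists2 j, j < n & k_cops_win e j)) => [[j lt /(IH j lt) [k h le]]|no].
  by exists k => //; apply: leq_trans le (ltnW lt).
by exists n => //; split=> // j lt w; apply: no; exists j.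
Qed.

Lemma cc_le4 (V : finType) (e : rel V) :
  simple_graph e -> connected_graph e -> bipartite e -> planar e ->
  exists2 k, is_cc e k & k <= 4.
Proof.
by move=> [esym _] ec [col colP] ep; apply/exists_cc/(four_cops_win esym colP).
Qed.

(** * The subdivided dodecahedron *)

Section SafeRobber.

Variables (V : finType) (e : rel V).

Definition within2 (c w : V) : bool := [exists d, adjr e c d && adjr e d w].

Lemma pigeonhole n (T : eqType) (rl : T -> 'I_n -> bool) (s : seq T) :
  (forall c i j, c \in s -> rl c i -> rl c j -> i = j) ->
  (forall i, exists2 c, c \in s & rl c i) -> n <= size s.
Proof.
move=> fn ex; have [f fs fr] := fin_all_exists2 ex.
rewrite -{1}(card_ord n) -(size_codom f); apply: uniq_leq_size.
  apply/injectiveP=> i j E; apply: (fn (f i)) => //; by rewrite E.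
by move=> c /codomP [i ->].
Qed.

Lemma all2_mem (T : eqType) (rl : rel T) s t y : all2 rl s t -> y \in t ->
  exists2 x, x \in s & rl x y.
Proof.
elim: s t => [|x s IH] [|z t] //= /andP [h /IH {}IH]; rewrite inE => /orP [/eqP->|/IH].
  by exists x; rewrite ?inE ?eqxx.
by case=> x' h1 h2; exists x'; rewrite ?inE ?h1 ?orbT.
Qed.

(** [mid v i] subdivides the [i]-th edge at the original vertex [v], and [opp v i] is the other end
    of that edge. *)
Variables (orig : pred V) (mid opp : V -> 'I_3 -> V).
Hypothesis esym : symmetric e.
Hypothesis mid_opp : forall v i, orig v ->
  [/\ e v (mid v i), e (mid v i) (opp v i) & orig (opp v i)].
Hypothesis mid_all : forall v u, orig v -> e v u -> exists i, u = mid v i.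
Hypothesis opp_inj : forall v c i j, orig v -> c != v ->
  within2 c (opp v i) -> within2 c (opp v j) -> i = j.
(** Starting vertices of which a cop reaches at most one in a single move, so that three cops leave
    one of them safe. *)
Variable spread : 'I_4 -> V.
Hypothesis spread_orig : forall i, orig (spread i).
Hypothesis spread_far : forall c i j,
  adjr e c (spread i) -> adjr e c (spread j) -> i = j.

(* The robber is either on an original vertex out of reach of the cops, or on
   a subdivision vertex on his way to an original vertex which no cop can
   reach in two moves. *)
Definition safe (cs : seq V) (r : V) : Prop :=
  size cs <= 3 /\
  ((orig r /\ {in cs, forall c, ~~ adjr e c r}) \/
   exists w, [/\ orig w, e r w & {in cs, forall c, ~~ within2 c w}]).

Lemma safe_step cs r cs' : safe cs r -> all2 (adjr e) cs cs' ->
  r \notin cs' /\ exists2 r', adjr e r r' & safe (rem r' cs') r'.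
Proof.
move=> [sz pos] mv.
have sz' : size cs' <= 3.
  by move: mv; rewrite all2E => /andP [/eqP <-].
have szr x : size (rem x cs') <= 3.
  by apply: leq_trans sz'; apply: size_subseq; apply: rem_subseq.
case: pos => [[or far]|[w [ow erw far]]]; last first.
  split.
    apply/negP=> /(all2_mem mv) [c /far nc cr]; move/negP: nc; apply.
    by apply/existsP; exists r; rewrite cr /adjr erw orbT.
  exists w; first by rewrite /adjr erw orbT.
  split=> //; left; split=> // c /mem_rem /(all2_mem mv) [c0 /far nc cc].
  by apply: contra nc => cw; apply/existsP; exists c; rewrite cc.
have rcs' : r \notin cs'.
  by apply/negP=> /(all2_mem mv) [c /far /negP].
split=> //.
have [/hasP [c cin cr]|/hasPn none] := boolP (has (fun c => adjr e c r) cs'); last first.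
  exists r; first by rewrite /adjr eqxx.
  by split=> //; left; split=> // c /mem_rem /none.
have cnr : c != r by apply: contraNneq rcs' => <-.
have [i0 ci0] : exists i, c = mid r i.
  apply: mid_all => //; move: cr; rewrite /adjr (negbTE cnr) /= => h.
  by rewrite esym.
(* The robber leaves along a subdivided edge if no cop who survives his first step can reach its far
   end within two moves. *)
case: (classic (exists i, {in rem (mid r i) cs', forall c, ~~ within2 c (opp r i)})).
  case=> i free; have [h1 h2 h3] := mid_opp i or.
  exists (mid r i); first by rewrite /adjr h1 orbT.
  by split=> //; right; exists (opp r i).
move=> block; exfalso.
(* If all ways are blocked, each cop blocks only one. The cop on [mid r i0] blocks only way [i0],
   where he would be removed, so the blockers can all be found among the other cops, who number at
   most two. *)
have: 3 <= size (rem (mid r i0) cs').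
  apply: (@pigeonhole _ _ (fun c i => within2 c (opp r i))).
    move=> c' i j /mem_rem c'in; apply: opp_inj => //.
    by apply: contraNneq rcs' => <-.
  move=> i; have [c' c'in wc'] : exists2 c', c' \in rem (mid r i) cs' & within2 c' (opp r i).
    apply: NNPP => nex; apply: block; exists i => c' c'in.
    by apply/negP=> wc'; apply: nex; exists c'.
  exists c' => //; case: (eqVneq i i0) => [<-//|ni].
  apply: mem_rem_neq (mem_rem c'in); apply: contraNneq ni => E.
  apply/eqP; apply: (@opp_inj r c') => //; first by rewrite E -ci0.
  have [h1 h2 h3] := mid_opp i0 or.
  by apply/existsP; exists (mid r i0); rewrite E /adjr eqxx h2 orbT.
rewrite size_rem -?ci0 //; move: sz'; case: (size cs') => // m le.
by rewrite /= leqNgt le.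
Qed.

Lemma safe_not_win cs r : safe cs r -> ~ cops_win e cs r.
Proof.
move=> sf win; move: cs r win sf; apply: cops_win_ind_nested => cs r cs' mv next sf.
have [rcs' [r' rr' sf']] := safe_step sf mv.
by case: next => [h|/(_ r' rr')]; [rewrite h in rcs' | apply].
Qed.

Lemma three_cops_lose k : k < 4 -> ~ k_cops_win e k.
Proof.
move=> k4 [cs [sz win]].
have [i free] : exists i, {in cs, forall c, ~~ adjr e c (spread i)}.
  apply: NNPP => nex.
  suff : 4 <= size cs by rewrite sz leqNgt k4.
  apply: (@pigeonhole _ _ (fun c i => adjr e c (spread i))).
    by move=> c i j _; apply: spread_far.
  move=> i; apply: NNPP => nex'; apply: nex; exists i => c ccs.
  by apply/negP=> h; apply: nex'; exists c.
apply: (@safe_not_win cs (spread i)) (win _).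
by split; [rewrite sz | left].
Qed.

End SafeRobber.

(** * Straight-line drawings with integer coordinates *)

Definition lerp (a b : Z) (t : R) : R := (IZR a + t * (IZR b - IZR a))%Re.

(** Twice the signed area of the triangle [a b c]. *)
Definition orient (a b c : Z * Z) : Z :=
  Z.sub (Z.mul (Z.sub b.1 a.1) (Z.sub c.2 a.2))
        (Z.mul (Z.sub b.2 a.2) (Z.sub c.1 a.1)).

(** Signs weakly agree and are not both zero: a segment may end on the line, but its interior avoids
    it. *)
Definition same_side (o o' : Z) : bool :=
  [&& Z.leb 0 o, Z.leb 0 o' & Z.ltb 0 o || Z.ltb 0 o'] ||
  [&& Z.leb o 0, Z.leb o' 0 & Z.ltb o 0 || Z.ltb o' 0].

Definition noncrossing (a b c d : Z * Z) : bool :=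
  same_side (orient a b c) (orient a b d) ||
  same_side (orient c d a) (orient c d b).

Definition segment (a b : Z * Z) (t : R) : R * R :=
  (lerp a.1 b.1 t, lerp a.2 b.2 t).

Lemma orient_segment a b c d t :
  ((IZR b.1 - IZR a.1) * ((segment c d t).2 - IZR a.2) -
   (IZR b.2 - IZR a.2) * ((segment c d t).1 - IZR a.1) =
   (1 - t) * IZR (orient a b c) + t * IZR (orient a b d))%Re.
Proof.
rewrite /orient !minus_IZR !mult_IZR !minus_IZR /segment /lerp /=; ring.
Qed.

Lemma orient_self a b : orient a b a = Z0 /\ orient a b b = Z0.
Proof. by rewrite /orient; split; ring. Qed.

(** Orientation with respect to [a b] is affine along [c d], hence nonzero inside it, and vanishes
    along [a b]. *)
Lemma same_side_segment a b c d s t : in01o t ->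
  same_side (orient a b c) (orient a b d) -> segment a b s <> segment c d t.
Proof.
move=> [t0 t1] ss E.
have := orient_segment a b c d t; rewrite -E orient_segment.
have [-> ->] := orient_self a b.
move: ss; rewrite /same_side; move: (orient a b c) (orient a b d) => o o'.
case/orP=> /and3P [/Z.leb_le/IZR_le h1 /Z.leb_le/IZR_le h2] /orP [];
  move=> /Z.ltb_lt/IZR_lt h3; nra.
Qed.

Lemma noncrossing_segment a b c d s t : in01o s -> in01o t ->
  noncrossing a b c d -> segment a b s <> segment c d t.
Proof.
move=> hs ht /orP [ss|ss]; first exact: same_side_segment.
by move=> /esym; apply: same_side_segment.
Qed.

Lemma segment_inj a b s t : a <> b -> segment a b s = segment a b t -> s = t.
Proof.
move=> ne [E1 E2]; move: E1 E2; rewrite /lerp.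
have : IZR b.1 <> IZR a.1 \/ IZR b.2 <> IZR a.2.
  apply: NNPP => h; apply: ne; rewrite (surjective_pairing a) (surjective_pairing b).
  by congr pair; apply: eq_IZR; apply: NNPP => h'; apply: h; [left|right] => /esym.
case=> h E1 E2.
  by apply: (Rmult_eq_reg_r (IZR b.1 - IZR a.1)); lra.
by apply: (Rmult_eq_reg_r (IZR b.2 - IZR a.2)); lra.
Qed.

(** [same_side o o] says that [o] is nonzero, so the condition on [z] keeps every other vertex off
    the line through an edge. All conditions are decidable by integer computation. *)
Lemma straight_line_planar (V : finType) (e : rel V) (P : V -> Z * Z) :
  irreflexive e -> injective P ->
  (forall x y z, e x y -> z != x -> z != y ->
     same_side (orient (P x) (P y) (P z)) (orient (P x) (P y) (P z))) ->
  (forall x y u w, e x y -> e u w ->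
     ~~ ((x == u) && (y == w) || (x == w) && (y == u)) ->
     noncrossing (P x) (P y) (P u) (P w)) ->
  planar e.
Proof.
move=> irr Pinj Pz Pe.
pose pos x := (IZR (P x).1, IZR (P x).2).
have posE x t : pos x = segment (P x) (P x) t.
  by rewrite /pos /segment /lerp; congr pair; ring.
have seg0 a b : segment a b 0 = (IZR a.1, IZR a.2).
  by rewrite /segment /lerp; congr pair; ring.
have seg1 a b : segment a b 1 = (IZR b.1, IZR b.2).
  by rewrite /segment /lerp; congr pair; ring.
have lerp_cont a b : continuity (lerp a b) by rewrite /lerp; reg.
exists pos, (fun x y => segment (P x) (P y)); split; [|split].
- move=> x y [E1 E2]; apply: Pinj.
  rewrite (surjective_pairing (P x)) (surjective_pairing (P y)).
  by rewrite (eq_IZR _ _ E1) (eq_IZR _ _ E2).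
- move=> x y exy; have ne : P x <> P y.
    by move=> /Pinj E; move: exy; rewrite E irr.
  split; first exact: lerp_cont.
  split; first exact: lerp_cont.
  split; first exact: seg0.
  split; first exact: seg1.
  split; first by move=> s t _ _; apply: segment_inj.
  move=> z s hs; case: (eqVneq z x) => [->|zx].
    by rewrite /pos -(seg0 _ (P y)) => /(segment_inj ne) E; case: hs; lra.
  case: (eqVneq z y) => [->|zy].
    by rewrite /pos -(seg1 (P x)) => /(segment_inj ne) E; case: hs; lra.
  by rewrite (posE z s); apply: same_side_segment => //; apply: Pz.
- move=> x y u w exy euw /negP ne s t hs ht.
  by apply: noncrossing_segment => //; apply: Pe.
Qed.

(* Adjacency lists and a straight-line drawing of the dodecahedron with every
   edge subdivided once, in breadth-first order; the vertices with three
   neighbours are those of the dodecahedron. *)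
Definition sdod_nbrs : seq (seq nat) :=
  [:: [:: 1; 2; 3]; [:: 0; 4]; [:: 0; 5]; [:: 0; 6]; [:: 1; 7; 8]; [:: 2;
  9; 10]; [:: 3; 11; 12]; [:: 4; 13]; [:: 4; 14]; [:: 5; 15]; [:: 5; 16];
  [:: 6; 17]; [:: 6; 18]; [:: 7; 19; 20]; [:: 8; 21; 22]; [:: 9; 20; 23];
  [:: 10; 24; 25]; [:: 11; 25; 26]; [:: 12; 22; 27]; [:: 13; 28]; [:: 13;
  15]; [:: 14; 29]; [:: 14; 18]; [:: 15; 30]; [:: 16; 31]; [:: 16; 17];
  [:: 17; 32]; [:: 18; 33]; [:: 19; 34; 35]; [:: 21; 35; 36]; [:: 23; 37;
  38]; [:: 24; 38; 39]; [:: 26; 40; 41]; [:: 27; 41; 42]; [:: 28; 43]; [::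
  28; 29]; [:: 29; 44]; [:: 30; 43]; [:: 30; 31]; [:: 31; 45]; [:: 32;
  45]; [:: 32; 33]; [:: 33; 44]; [:: 34; 37; 46]; [:: 36; 42; 47]; [:: 39;
  40; 48]; [:: 43; 49]; [:: 44; 49]; [:: 45; 49]; [:: 46; 47; 48]].

Definition sdod_coords : seq (Z * Z) :=
  [:: (40, 0); (31, 5); (58, -2); (29, -10); (20, 15); (80, 0); (20, -15);
  (16, 27); (15, 9); (54, 38); (53, -36); (16, -27); (16, -9); (12, 38);
  (9, 6); (25, 76); (25, -76); (12, -38); (9, -6); (2, 33); (18, 59); (5,
  9); (10, 2); (-18, 61); (-18, -63); (20, -57); (4, -30); (1, -6); (-8,
  24); (-3, 10); (-65, 47); (-65, -47); (-8, -24); (-3, -10); (-21, 25);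
  (-7, 19); (-5, 7); (-49, 37); (-66, 1); (-49, -36); (-19, -23); (-6,
  -16); (-9, -7); (-33, 24); (-11, 0); (-33, -24); (-30, 12); (-20, -2);
  (-28, -11); (-25, 0)]%Z.

Definition sdod_edge (i j : nat) : bool := j \in nth [::] sdod_nbrs i.

Definition sdod : rel 'I_50 := fun x y => sdod_edge x y.

Definition sdod_orig (i : nat) : bool := size (nth [::] sdod_nbrs i) == 3.

Definition sdod_arcs : seq (nat * nat) :=
  [seq (i, j) | i <- iota 0 50, j <- nth [::] sdod_nbrs i].

Definition sdod_mid (v i : nat) : nat := nth 0 (nth [::] sdod_nbrs v) i.

Definition sdod_opp (v i : nat) : nat :=
  let m := nth [::] sdod_nbrs (sdod_mid v i) in
  if nth 0 m 0 == v then nth 0 m 1 else nth 0 m 0.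

Definition sdod_adj (i j : nat) : bool := (i == j) || sdod_edge i j.

Definition sdod_within2 (c w : nat) : bool :=
  has (fun d => sdod_adj d w) (c :: nth [::] sdod_nbrs c).

Lemma ord_all n (P : pred nat) : all P (iota 0 n) -> forall x : 'I_n, P x.
Proof. by move=> /allP h x; apply: h; rewrite mem_iota /=. Qed.

Lemma sdod_arcP (x y : 'I_50) : sdod x y -> (x : nat, y : nat) \in sdod_arcs.
Proof.
move=> h; apply/allpairsPdep; exists (x : nat), (y : nat).
by rewrite mem_iota ltn_ord.
Qed.

Lemma sdod_sym : symmetric sdod.
Proof.
suff H (x y : 'I_50) : sdod x y -> sdod y x by move=> x y; apply/idP/idP; apply: H.
have : all (fun a => sdod_edge a.2 a.1) sdod_arcs by vm_compute.
by move=> /allP h /sdod_arcP /h.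
Qed.

Lemma sdod_bip (x y : 'I_50) : sdod x y -> sdod_orig x != sdod_orig y.
Proof.
have : all (fun a => sdod_orig a.1 != sdod_orig a.2) sdod_arcs by vm_compute.
by move=> /allP h /sdod_arcP /h.
Qed.

Lemma sdod_irr : irreflexive sdod.
Proof. by move=> x; apply/negP=> /sdod_bip; rewrite eqxx. Qed.

Lemma sdod_connected : connected_graph sdod.
Proof.
split; first by rewrite card_ord.
suff H (x : 'I_50) : connect sdod ord0 x.
  move=> x y; apply: connect_trans (H y).
  by rewrite (sym_connect_sym sdod_sym) H.
(* In the breadth-first numbering every vertex except 0 has a neighbour with a smaller number. *)
have par : all (fun i => (i == 0) || has (fun j => j < i) (nth [::] sdod_nbrs i))
  (iota 0 50) by vm_compute.
case: x => i; elim/ltn_ind: i => i IH lt50.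
have := ord_all par (Ordinal lt50); case/orP=> /= [/eqP i0|/hasP [j jn ltj]].
  by rewrite (_ : Ordinal lt50 = ord0) ?connect0 //; apply: val_inj.
have j50 := ltn_trans ltj lt50.
apply: connect_trans (IH j ltj j50) _; apply: connect1.
by rewrite sdod_sym.
Qed.

Lemma sdod_planar : planar sdod.
Proof.
pose P (i : nat) := nth (Z0, Z0) sdod_coords i.
apply: (@straight_line_planar _ _ (fun x : 'I_50 => P x) sdod_irr).
- have chk : all (fun i => all (fun j => (i == j) ||
      ~~ (Z.eqb (P i).1 (P j).1 && Z.eqb (P i).2 (P j).2)) (iota 0 50))
    (iota 0 50) by vm_compute.
  move=> x y E; have := ord_all (ord_all chk x) y.
  by rewrite E !Z.eqb_refl orbF => /eqP/val_inj.
- have : all (fun a => all (fun z => (z == a.1) || (z == a.2) ||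
      same_side (orient (P a.1) (P a.2) (P z)) (orient (P a.1) (P a.2) (P z)))
      (iota 0 50)) sdod_arcs by vm_compute.
  move=> /allP h x y z /sdod_arcP /h /ord_all /(_ z).
  by case/orP=> [/orP [] /= /eqP/val_inj ->|//]; rewrite eqxx.
- have : all (fun a => all (fun b =>
      ((a.1 == b.1) && (a.2 == b.2) || (a.1 == b.2) && (a.2 == b.1)) ||
      noncrossing (P a.1) (P a.2) (P b.1) (P b.2)) sdod_arcs) sdod_arcs by vm_compute.
  move=> /allP h x y u w /sdod_arcP /h /allP h' /sdod_arcP /h' /orP [|//].
  by rewrite /= -!val_eqE => ->.
Qed.

Lemma sdod_three_cops_lose k : k < 4 -> ~ k_cops_win sdod k.
Proof.
pose mid (v : 'I_50) (i : 'I_3) : 'I_50 := inord (sdod_mid v i).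
pose opp (v : 'I_50) (i : 'I_3) : 'I_50 := inord (sdod_opp v i).
(* Four pairwise nonadjacent vertices of the dodecahedron; after subdivision no vertex is within one
   move of two of them. *)
pose spread (i : 'I_4) : 'I_50 := inord (nth 0 [:: 0; 13; 14; 16] i).
have adjE (x y : 'I_50) : adjr sdod x y = sdod_adj x y by [].
have vals : all (fun v => sdod_orig v ==> all (fun i =>
    [&& sdod_mid v i < 50, sdod_opp v i < 50, sdod_edge v (sdod_mid v i),
        sdod_edge (sdod_mid v i) (sdod_opp v i) & sdod_orig (sdod_opp v i)])
    (iota 0 3)) (iota 0 50) by vm_compute.
have valsP (v : 'I_50) (i : 'I_3) : sdod_orig v ->
    [/\ mid v i = sdod_mid v i :> nat, opp v i = sdod_opp v i :> nat,
        sdod v (mid v i), sdod (mid v i) (opp v i) & sdod_orig (opp v i)].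
  move=> ov; have /implyP/(_ ov)/ord_all/(_ i) := ord_all vals v.
  by case/and5P=> h1 h2; rewrite /sdod /mid /opp !inordK.
have w2P (c w : 'I_50) : within2 sdod c w -> sdod_within2 c w.
  case/existsP=> d /andP [cd dw]; apply/hasP; exists (d : nat) => //.
  move: cd; rewrite inE adjE => /orP [/eqP->|h]; first by rewrite eqxx.
  by apply/orP; right.
have spreadE i : spread i = nth 0 [:: 0; 13; 14; 16] i :> nat.
  by rewrite inordK //; case: i => [[|[|[|[|//]]]]].
apply: (@three_cops_lose _ _ (fun v : 'I_50 => sdod_orig v) mid opp sdod_sym _ _ _ spread).
- by move=> v i /(valsP v i) [].
- move=> v u ov; have [m _ _ _ _] := valsP v ord0 ov.
  rewrite /sdod /sdod_edge => /(nthP 0) [i].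
  rewrite (eqP ov) => lt E; exists (Ordinal lt); apply: val_inj.
  by have [/= -> _ _ _ _] := valsP v (Ordinal lt) ov.
- have chk : all (fun v => sdod_orig v ==> all (fun c => (c == v) || all (fun i =>
      all (fun j => [|| i == j, ~~ sdod_within2 c (sdod_opp v i) |
         ~~ sdod_within2 c (sdod_opp v j)]) (iota 0 3)) (iota 0 3))
    (iota 0 50)) (iota 0 50) by vm_compute.
  move=> v c i j ov cv /w2P h1 /w2P h2.
  have /implyP/(_ ov)/ord_all/(_ c) := ord_all chk v.
  rewrite val_eqE (negbTE cv) orFb => /ord_all/(_ i)/ord_all/(_ j).
  have [_ <- _ _ _] := valsP v i ov; have [_ <- _ _ _] := valsP v j ov.
  by rewrite h1 h2 !orbF => /eqP/val_inj.
- by case=> [[|[|[|[|//]]]]] lt; rewrite /= spreadE.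
- have chk : all (fun c => all (fun i => all (fun j =>
      [|| i == j, ~~ sdod_adj c (nth 0 [:: 0; 13; 14; 16] i) |
         ~~ sdod_adj c (nth 0 [:: 0; 13; 14; 16] j)]) (iota 0 4)) (iota 0 4))
    (iota 0 50) by vm_compute.
  move=> c i j; rewrite !adjE !spreadE => h1 h2.
  have := ord_all (ord_all (ord_all chk c) i) j.
  by rewrite h1 h2 !orbF => /eqP/val_inj.
Qed.

Theorem theorem5 :
  (forall (V : finType) (e : rel V),
      simple_graph e -> connected_graph e -> bipartite e -> planar e ->
      exists2 k, is_cc e k & k <= 4) /\
  (exists (V : finType) (e : rel V),
      simple_graph e /\ connected_graph e /\ bipartite e /\ planar e /\
      is_cc e 4).
Proof.
split; first exact: cc_le4.
have simple : simple_graph sdod by split; [exact: sdod_sym | exact: sdod_irr].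
have bip : bipartite sdod by exists (fun x => sdod_orig (val x)); apply: sdod_bip.
exists 'I_50, sdod; split=> //; split; first exact: sdod_connected.
split=> //; split; first exact: sdod_planar.
have [k [win least] le4] := cc_le4 simple sdod_connected bip sdod_planar.
have k4 : k = 4.
  by apply/eqP; rewrite eqn_leq le4 leqNgt; apply/negP=> /sdod_three_cops_lose.
by split; [move: win; rewrite k4 | exact: sdod_three_cops_lose].
Qed.
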